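(* Let $L>0$, let $a$ satisfy (H_a), $g\in L^2(0,L)$, and let $\phi$ satisfy (H_φ) together with $\phi(0)=+\infty$. Let $(a_n,g_n,\phi_n)$ be approximating data satisfying (H_approx). Then for every $n$ there exists at least one function $u_n$ satisfying $$u_n\in H^1_0(0,L),\qquad \int_0^L a_n u_n' z'\,dx=\int_0^L\phi_n(u_n) z'\,dx+\int_0^L g_n z'\,dx\quad\forall z\in H^1_0(0,L),$$ and every such $u_n$ satisfies $\|u_n'\|_{L^2(0,L)}\le \frac{1}{\alpha}\|g_n\|_{L^2(0,L)}\le \frac{c_0}{\alpha}$. Moreover, if a subsequence $u_{n'}$ of such functions converges weakly in $H^1_0(0,L)$ (and a.e.) to some $u\in H^1_0(0,L)$, then either $u\equiv 0$, or $u$ is a weak solution of problem (P) with data $(a,g,\phi)$.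
   Context: Prime denotes $d/dx$. (H_a): $a\in L^\infty(0,L)$ and there are constants $0<\alpha<\beta$ with $\alpha\le a(x)\le\beta$ for a.e. $x\in(0,L)$. (H_φ): $\phi:\mathbb{R}\to\mathbb{R}\cup\{+\infty\}$ is continuous when $\mathbb{R}\cup\{+\infty\}$ carries its usual topology (neighbourhoods of $+\infty$ contain some $(M,+\infty]$), and $\phi(s)<+\infty$ for every $s\neq 0$. Problem (P) with data $(a,g,\phi)$ is formally $-\frac{d}{dx}(a\frac{du}{dx})=-\frac{d\phi(u)}{dx}-\frac{dg}{dx}$ in $(0,L)$, $u(0)=u(L)=0$. A weak solution of (P) is a function $u$ with $u\in H^1_0(0,L)$, $\phi(u)\in L^2(0,L)$, and $-\frac{d}{dx}(a\frac{du}{dx})=-\frac{d\phi(u)}{dx}-\frac{dg}{dx}$ in $\mathcal D'(0,L)$. A sequence $(\phi_n)$ is a reasonable approximation of $\phi$ if each $\phi_n$ satisfies (H_φ) and, for every real sequence $s_n\to s\in\mathbb{R}$, one has $\phi_n(s_n)\to\phi(s)$ in $\mathbb{R}\cup\{+\infty\}$. (H_approx): $a_n\in L^\infty(0,L)$ with $\alpha\le a_n\le\beta$ a.e. (same $\alpha,\beta$) and $a_n\to a$ a.e. in $(0,L)$; $g_n\in L^2(0,L)$ with $\|g_n\|_{L^2}\le c_0$ for a fixed $c_0>0$ and $g_n\rightharpoonup g$ weakly in $L^2(0,L)$; $(\phi_n)$ is a reasonable approximation of $\phi$ and $\phi_n\in C^0(\mathbb{R})$ (real-valued continuous) for each $n$.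 *)

(* Defs.v *)
From HB Require Import structures.
From mathcomp Require Import all_boot all_order all_algebra.
From mathcomp Require Import all_classical all_reals all_analysis.
Set Implicit Arguments. Unset Strict Implicit. Unset Printing Implicit Defensive.
Import Order.TTheory GRing.Theory Num.Theory numFieldNormedType.Exports.
Local Open Scope classical_set_scope.
Local Open Scope ring_scope.

Section Defs.
Variable R : realType.
Local Notation mu := (@lebesgue_measure R).

Definition L2 (L : R) (f : R -> R) : Prop :=
  measurable_fun `[0, L]%classic f /\
  let D := `[0, L]%classic in (\int[mu]_(x in D) ((f x) ^+ 2)%:E < +oo)%E.

Definition L2norm (L : R) (f : R -> R) : R :=
  Num.sqrt (Rintegral mu `[0, L]%classic (fun x => (f x) ^+ 2)).

Definition ae_on (L : R) (P : R -> Prop) : Prop :=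
  {ae mu, forall x, `]0, L[%classic x -> P x}.

(* u is (the continuous representative of) an element of H^1_0(0,L),
   with weak derivative du : u(x) = int_0^x du, du in L^2, u(0)=u(L)=0. *)
Definition H10 (L : R) (u du : R -> R) : Prop :=
  L2 L du /\ (forall x, 0 <= x <= L -> u x = Rintegral mu `[0, x]%classic du) /\
  u L = 0.

Definition test_fun (L : R) (psi : R -> R) : Prop :=
  (forall (k : nat) (x : R), derivable (iter k (@derive1 R R) psi) x 1) /\
  exists c d : R, [/\ 0 < c, c <= d, d < L &
     forall x, x < c \/ d < x -> psi x = 0].

Definition approx_eq (L : R) (an gn : R -> R) (phin : R -> R) (u du : R -> R)
  : Prop :=
  forall z dz, H10 L z dz ->
    Rintegral mu `[0, L]%classic (fun x => an x * du x * dz x) =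
    Rintegral mu `[0, L]%classic (fun x => phin (u x) * dz x) +
    Rintegral mu `[0, L]%classic (fun x => gn x * dz x).

Definition weak_solution (L : R) (a g : R -> R) (phi : R -> \bar R)
  (u du : R -> R) : Prop :=
  H10 L u du /\
  exists f : R -> R, L2 L f /\ ae_on L (fun x => phi (u x) = (f x)%:E) /\
   forall psi, test_fun L psi ->
    Rintegral mu `[0, L]%classic (fun x => a x * du x * derive1 psi x) =
    Rintegral mu `[0, L]%classic (fun x => f x * derive1 psi x) +
    Rintegral mu `[0, L]%classic (fun x => g x * derive1 psi x).

Definition H_phi (phi : R -> \bar R) : Prop :=
  continuous phi /\ (forall s, phi s != -oo%E) /\
  (forall s, s != 0 -> phi s != +oo%E).

Definition reasonable_approx (phin : nat -> R -> R) (phi : R -> \bar R) : Prop :=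
  forall (s : nat -> R) (s0 : R), s @ \oo --> s0 ->
    (fun n => (phin n (s n))%:E) @ \oo --> phi s0.
End Defs.

(* Main.v *)
Require Import Defs.
From HB Require Import structures.
From mathcomp Require Import all_boot all_order all_algebra.
From mathcomp Require Import all_classical all_reals all_analysis.
From mathcomp Require Import measurable_realfun.
From mathcomp Require Import ring lra.
Import Order.TTheory GRing.Theory Num.Theory numFieldNormedType.Exports.
Local Open Scope classical_set_scope.
Local Open Scope ring_scope.

(** Existence for fixed [n]: testing the equation with [u] itself kills the [phi]
term, since [phi(u) u'] is an exact derivative and [u] vanishes at both ends.
This gives the energy estimate and an a priori sup bound, so [phi] may be
truncated to a bounded function. In dimension one the equation then integrates
to [u' = (phi(u) + g + c) / a] for a constant [c]. With [phi(u(t - h))] in place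
of [phi(u(t))] it is solved explicitly on successive intervals of length [h]; the
intermediate value theorem selects [c] so that [u(L) = 0], and compactness as
[h -> 0] removes the delay.

Limit: if [u] is not identically [0], then on an interval where [u] stays away
from [0] the functions [phi_n(u_n)] are eventually under control, which bounds
the constants [c_n], hence [phi_n(u_n) = a_n u_n' - g_n - c_n] in [L^2(0,L)].
Fatou's lemma puts [phi(u)] in [L^2], and [L^2]-boundedness with a.e. convergence
gives [L^1] convergence, which suffices to pass to the limit against test functions. *)

(** Functions of $H^1_0$ come as pairs [u], [du] with [u] the primitive of [du], so the derivatives
    of test functions are exactly the mean-free elements of $L^2$. The constant $c$ of the
    integrated equation is the multiplier of the constraint $\int z' = 0$; testing with the
    mean-free part of the residual recovers it.

    As $\phi$ is only continuous, the Cauchy problem for fixed $c$ may have many solutions, and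
    $u(L)$ need not be a function of $c$. The delay restores uniqueness and continuity in $c$.
    Moreover $u(L)$ is a bounded quantity plus $c\int 1/a$, which bounds the selected $c$
    independently of $h$ and supplies the compactness.

    In the limit, the energy estimate says nothing about the constants $c_n$. A large $|c_n|$ would
    make $|\phi_n(u_n)|$ large outside a set of small measure, which is impossible on an interval
    where $\phi_n(u_n)$ has a bounded limit. The product $a_n u_n'$ is handled by moving $a_n$ onto
    the test function, where it converges strongly. *)

Section RealIntegrable.
Local Set Implicit Arguments.
Local Unset Strict Implicit.
Context {R : realType}.
Local Notation mu := (@lebesgue_measure R).
Implicit Types (D E : set (measurableTypeR R)) (f g : R -> R) (L : R).

(** * Almost-everywhere statements and real-valued integrals *)

Lemma ae_imp (P Q : R -> Prop) : (forall x, P x -> Q x) ->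
  {ae mu, forall x, P x} -> {ae mu, forall x, Q x}.
Proof.
move=> PQ [A [mA A0 PA]]; exists A; split => // x nQ.
by apply: PA => /PQ.
Qed.

Lemma ae_and (P Q : R -> Prop) : {ae mu, forall x, P x} ->
  {ae mu, forall x, Q x} -> {ae mu, forall x, P x /\ Q x}.
Proof.
move=> hP hQ; have := negligibleU hP hQ; apply: negligibleS => x /= h.
by apply/not_andP => -[Px Qx]; apply: h.
Qed.

Lemma ae_foralln (P : nat -> R -> Prop) : (forall n, {ae mu, forall x, P n x}) ->
  {ae mu, forall x, forall n, P n x}.
Proof.
move=> h; have := negligible_bigcup h; apply: negligibleS => x /= /existsNP[n nP].
by exists n.
Qed.

Lemma integrable_EFinD D f g : measurable D ->
  mu.-integrable D (EFin \o f) -> mu.-integrable D (EFin \o g) ->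
  mu.-integrable D (EFin \o (fun x => f x + g x)).
Proof. by move=> mD fi gi; exact: (integrableD mD fi gi). Qed.

Lemma integrable_EFinB D f g : measurable D ->
  mu.-integrable D (EFin \o f) -> mu.-integrable D (EFin \o g) ->
  mu.-integrable D (EFin \o (fun x => f x - g x)).
Proof. by move=> mD fi gi; exact: (integrableB mD fi gi). Qed.

Lemma integrable_EFinZ D f r : measurable D ->
  mu.-integrable D (EFin \o f) ->
  mu.-integrable D (EFin \o (fun x => r * f x)).
Proof. by move=> mD fi; exact: (integrableZl mD r fi). Qed.

Lemma integrable_EFin_norm D f :
  mu.-integrable D (EFin \o f) ->
  mu.-integrable D (EFin \o (fun x => `|f x|)).
Proof. exact: integrable_norm. Qed.

Lemma integrable_EFin_measurable D f :
  mu.-integrable D (EFin \o f) -> measurable_fun D f.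
Proof. by move=> /integrableP[/measurable_EFinP]. Qed.

Lemma integrable_EFin_dom D f g : measurable D -> measurable_fun D f ->
  (forall x, D x -> `|f x| <= g x) -> mu.-integrable D (EFin \o g) ->
  mu.-integrable D (EFin \o f).
Proof.
move=> mD mf fg; apply: le_integrable => //; first exact/measurable_EFinP.
by move=> x Dx; rewrite /= lee_fin (le_trans (fg x Dx))// ler_norm.
Qed.

Lemma lebesgue_measure_0L L : 0 <= L -> mu `[0, L]%classic = L%:E.
Proof.
move=> L0; rewrite lebesgue_measure_itv/= lte_fin.
by case: ltP => [_|L0']; [rewrite oppr0 adde0|congr EFin; lra].
Qed.

Lemma lebesgue_measure_0L_lty L : (mu `[0%R, L]%classic < +oo)%E.
Proof. by rewrite lebesgue_measure_itv/=; case: ifP => // _; rewrite -EFinB ltry. Qed.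

Lemma integrable_cst_0L L r : mu.-integrable `[0, L]%classic (EFin \o (fun _ => r)).
Proof.
apply: measurable_bounded_integrable => //; first exact: lebesgue_measure_0L_lty.
exists `|r|; split; first exact: num_real.
by move=> M rM x _ /=; exact: ltW.
Qed.

Lemma Rintegral_cst_0L L r : 0 <= L ->
  Rintegral mu `[0, L]%classic (fun _ => r) = r * L.
Proof.
move=> L0; rewrite Rintegral_cst//.
by have /= h := lebesgue_measure_0L L0; rewrite [X in fine X]h.
Qed.

(** Data are controlled a.e. on the open interval while integrals run over the closed one; the two
    endpoints are null. *)
Lemma ae_on_cc L (P : R -> Prop) : ae_on L P ->
  {ae mu, forall x, `[0, L]%classic x -> P x}.
Proof.
have ne (r : R) : {ae mu, forall x, x <> r}.
  exists [set r]; split => //; first exact: lebesgue_measure_set1.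
  by move=> x /= /contrapT.
move=> h; apply: (ae_imp _ (ae_and h (ae_and (ne 0) (ne L)))) => x [+ [x0 xL]] xD; apply.
move: xD => /=; rewrite !in_itv/= => /andP[].
rewrite !le_eqVlt => /predU1P[/esym//|->] /predU1P[//|->] //.
Qed.

Lemma Rintegral_ae_eq D f g : measurable D ->
  measurable_fun D f -> measurable_fun D g ->
  {ae mu, forall x, D x -> f x = g x} ->
  Rintegral mu D f = Rintegral mu D g.
Proof.
move=> mD mf mg fg; rewrite /Rintegral; congr fine.
apply: ae_eq_integral => //; try exact/measurable_EFinP.
by apply: filterS fg => x + Dx => /(_ Dx) ->.
Qed.

Lemma integrable_EFin_ae_dom D f g : measurable D -> measurable_fun D f ->
  {ae mu, forall x, D x -> `|f x| <= g x} -> mu.-integrable D (EFin \o g) ->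
  mu.-integrable D (EFin \o f).
Proof.
move=> mD mf fg /integrableP[mg gi]; apply/integrableP; split.
  exact/measurable_EFinP.
apply: le_lt_trans gi; apply: ae_ge0_le_integral => //.
- by apply: measurableT_comp => //; exact/measurable_EFinP.
- exact: measurableT_comp.
- apply: (ae_imp _ fg) => x fgx Dx /=; rewrite lee_fin.
  by rewrite (le_trans (fgx Dx))// ler_norm.
Qed.

(** [f] agrees a.e. with the minimum of [f] and [g], which lies below [g] at every point, so the
    pointwise comparison of integrals applies. *)
Lemma ae_le_Rintegral D f g : measurable D ->
  mu.-integrable D (EFin \o f) -> mu.-integrable D (EFin \o g) ->
  {ae mu, forall x, D x -> f x <= g x} ->
  Rintegral mu D f <= Rintegral mu D g.
Proof.
move=> mD fi gi fg.
have mf := integrable_EFin_measurable fi; have mg := integrable_EFin_measurable gi.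
have mm : measurable_fun D (fun x => Num.min (f x) (g x)) by exact: measurable_minr.
have mi : mu.-integrable D (EFin \o (fun x => Num.min (f x) (g x))).
  apply: (@integrable_EFin_dom _ _ (fun x => `|f x| + `|g x|)) => //.
    by move=> x _; case: (leP (f x) (g x)) => _; rewrite ?lerDl ?lerDr.
  by apply: integrable_EFinD => //; exact: integrable_EFin_norm.
rewrite (@Rintegral_ae_eq D f (fun x => Num.min (f x) (g x)))//.
  by apply: le_Rintegral => // x _; rewrite ge_min lexx orbT.
by apply: (ae_imp _ fg) => x h Dx; rewrite min_l// h.
Qed.

(** * Square-integrable functions on [[0, L]] *)

Lemma L2_integrable_sqr L f : L2 L f ->
  mu.-integrable `[0, L]%classic (EFin \o (fun x => f x ^+ 2)).
Proof.
move=> [mf fi]; apply/integrableP; split.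
  by apply/measurable_EFinP; exact: measurable_funX.
by under eq_integral do rewrite /= ger0_norm ?sqr_ge0//.
Qed.

Lemma L2P L f : measurable_fun `[0, L]%classic f ->
  mu.-integrable `[0, L]%classic (EFin \o (fun x => f x ^+ 2)) -> L2 L f.
Proof.
move=> mf /integrableP[_ fi]; split => //=.
by move: fi; under eq_integral do rewrite /= ger0_norm ?sqr_ge0//.
Qed.

Lemma L2M_integrable L f g : L2 L f -> L2 L g ->
  mu.-integrable `[0, L]%classic (EFin \o (fun x => f x * g x)).
Proof.
move=> Lf Lg; have [mf _] := Lf; have [mg _] := Lg.
apply: (@integrable_EFin_dom _ _ (fun x => f x ^+ 2 + g x ^+ 2)) => //.
- exact: measurable_funM.
- by move=> x _; have := sqr_ge0 (f x + g x); have := sqr_ge0 (f x - g x); rewrite ler_norml; nra.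
- by apply: integrable_EFinD => //; exact: L2_integrable_sqr.
Qed.

Lemma L2_cst L r : L2 L (fun _ => r).
Proof. by apply: L2P => //; exact: integrable_cst_0L. Qed.

Lemma L2_integrable L f : L2 L f -> mu.-integrable `[0, L]%classic (EFin \o f).
Proof.
move=> Lf; have := L2M_integrable Lf (L2_cst L 1).
by congr integrable; apply/funext => x /=; rewrite mulr1.
Qed.

Lemma L2D L f g : L2 L f -> L2 L g -> L2 L (fun x => f x + g x).
Proof.
move=> Lf Lg; have [mf _] := Lf; have [mg _] := Lg.
apply: L2P; first exact: measurable_funD.
apply: (@integrable_EFin_dom _ _ (fun x => 2 * (f x ^+ 2 + g x ^+ 2))) => //.
- by apply: measurable_funX; exact: measurable_funD.
- move=> x _; rewrite ger0_norm ?sqr_ge0// -subr_ge0.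
  by rewrite (_ : _ - _ = (f x - g x) ^+ 2) ?sqr_ge0//; ring.
- by apply: integrable_EFinZ => //; apply: integrable_EFinD => //; exact: L2_integrable_sqr.
Qed.

Lemma L2_dom L f g : measurable_fun `[0, L]%classic f ->
  {ae mu, forall x, `[0, L]%classic x -> `|f x| <= `|g x|} -> L2 L g -> L2 L f.
Proof.
move=> mf fg Lg; apply: L2P => //.
apply: (@integrable_EFin_ae_dom _ _ (fun x => g x ^+ 2)) => //.
- exact: measurable_funX.
- apply: (ae_imp _ fg) => x fgx Dx; rewrite normrX -[leRHS]real_normK ?num_real//.
  by rewrite lerXn2r ?nnegrE// fgx.
- exact: L2_integrable_sqr.
Qed.

Lemma L2_bndM L K f g : measurable_fun `[0, L]%classic f ->
  {ae mu, forall x, `[0, L]%classic x -> `|f x| <= K} -> L2 L g ->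
  L2 L (fun x => f x * g x).
Proof.
move=> mf fK Lg; have [mg _] := Lg; apply: (@L2_dom _ _ (fun x => K * g x)).
- exact: measurable_funM.
- apply: (ae_imp _ fK) => x fKx Dx; rewrite !normrM ler_wpM2r//.
  by rewrite (le_trans (fKx Dx))// ler_norm.
- apply: L2P; first exact: measurable_funM.
  have := integrable_EFinZ (K ^+ 2) (measurable_itv _) (L2_integrable_sqr Lg).
  by congr integrable; apply/funext => x /=; rewrite exprMn.
Qed.

Lemma L2Z L r f : L2 L f -> L2 L (fun x => r * f x).
Proof. by apply: (@L2_bndM _ `|r|) => //; exact: aeW. Qed.

Lemma L2B L f g : L2 L f -> L2 L g -> L2 L (fun x => f x - g x).
Proof.
move=> Lf Lg; have := L2D Lf (L2Z (-1) Lg).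
by congr L2; apply/funext => x; rewrite mulN1r.
Qed.

Lemma L2_norm L f : L2 L f -> L2 L (fun x => `|f x|).
Proof.
move=> Lf; have [mf _] := Lf; apply: (@L2_dom _ _ f) => //.
  exact: measurableT_comp.
by apply: aeW => x _; rewrite normr_id.
Qed.

Lemma L2_bounded L K f : measurable_fun `[0, L]%classic f ->
  (forall x, `[0, L]%classic x -> `|f x| <= K) -> L2 L f.
Proof.
move=> mf fK; apply: (@L2_dom _ _ (fun _ => K)) => //; last exact: L2_cst.
by apply: aeW => x /fK fx; rewrite (le_trans fx)// ler_norm.
Qed.

(** The polynomial $t \mapsto \int (tf+g)^2 = t^2A + 2tC + B$ is nonnegative; its value at the
    minimiser $-C/A$ gives $C^2 \le AB$. *)
Lemma Cauchy_Schwarz_L2 L f g : L2 L f -> L2 L g ->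
  `|Rintegral mu `[0, L]%classic (fun x => f x * g x)| <= L2norm L f * L2norm L g.
Proof.
move=> Lf Lg; rewrite /L2norm.
set A := Rintegral mu _ (fun x => f x ^+ 2); set B := Rintegral mu _ (fun x => g x ^+ 2).
set C := Rintegral mu _ (fun x => f x * g x).
have A0 : 0 <= A by apply: Rintegral_ge0 => x _; rewrite sqr_ge0.
have B0 : 0 <= B by apply: Rintegral_ge0 => x _; rewrite sqr_ge0.
have key t : 0 <= t ^+ 2 * A + 2 * t * C + B.
  have -> : t ^+ 2 * A + 2 * t * C + B =
     Rintegral mu `[0, L]%classic (fun x => (t * f x + g x) ^+ 2).
    rewrite -RintegralZl//; last exact: L2_integrable_sqr.
    rewrite -RintegralZl//; last exact: L2M_integrable.
    rewrite -RintegralD//; first last.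
    - by apply: integrable_EFinZ => //; exact: L2M_integrable.
    - by apply: integrable_EFinZ => //; exact: L2_integrable_sqr.
    rewrite -RintegralD//; first last.
    - exact: L2_integrable_sqr.
    - apply: integrable_EFinD => //; apply: integrable_EFinZ => //.
        exact: L2_integrable_sqr.
      exact: L2M_integrable.
    by apply: eq_Rintegral => x _; ring.
  by apply: Rintegral_ge0 => x _; rewrite sqr_ge0.
rewrite -sqrtrM// -sqrtr_sqr ler_sqrt//; last exact: mulr_ge0.
have [A00|An0] := eqVneq A 0.
  have [->|C0] := eqVneq C 0; first by rewrite expr0n mulr_ge0.
  (* With [A = 0] the polynomial is affine, and at this [t] it equals [-1]. *)
  have := key (- (B + 1) / (2 * C)); rewrite A00.
  have -> : 2 * (- (B + 1) / (2 * C)) * C = - (B + 1) by field.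
  by lra.
have := key (- C / A).
have -> : (- C / A) ^+ 2 * A + 2 * (- C / A) * C + B = (A * B - C ^+ 2) / A by field.
have Ap : 0 < A by rewrite lt_neqAle eq_sym An0.
by rewrite pmulr_lge0 ?invr_gt0// subr_ge0.
Qed.

Lemma sqr_L2norm L f : L2norm L f ^+ 2 =
  Rintegral mu `[0, L]%classic (fun x => f x ^+ 2).
Proof. by rewrite /L2norm sqr_sqrtr//; apply: Rintegral_ge0 => x _; rewrite sqr_ge0. Qed.

Lemma L2norm_ge0 L f : 0 <= L2norm L f.
Proof. exact: sqrtr_ge0. Qed.

End RealIntegrable.

(** * Uniform continuity, primitives, and the chain rule for $\phi(u)u'$ *)

Section Primitives.
Local Set Implicit Arguments.
Local Unset Strict Implicit.
Context {R : realType}.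
Local Notation mu := (@lebesgue_measure R).
Implicit Types (D E : set (measurableTypeR R)) (f g : R -> R) (L : R).

Lemma within_continuous_dist (A : set R) (f : R -> R) (x e : R) :
  {within A, continuous f} -> A x -> 0 < e ->
  exists2 d : R, 0 < d & forall y, A y -> `|x - y| < d -> `|f x - f y| < e.
Proof.
move=> /subspace_continuousP cf Ax e0; have /cvgrPdist_lt/(_ e e0) := cf x Ax.
rewrite near_withinE => /nbhs_ballP[d /= d0 h].
by exists d => // y Ay xy; exact: (h y xy Ay).
Qed.

(** Heine's theorem from the near-covering form of compactness, the candidate [d] ranging over right
    neighbourhoods of [0]. Halving the radius at [x] keeps both [x'] and [y] inside the ball of
    radius [r] around [x]. *)
Lemma within_unif_continuous (a b : R) (f : R -> R) (e : R) :
  {within `[a, b], continuous f} -> 0 < e ->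
  exists2 d : R, 0 < d & forall x y, a <= x <= b -> a <= y <= b ->
    `|x - y| < d -> `|f x - f y| < e.
Proof.
move=> cf e0.
have /compact_near_coveringP := @segment_compact R a b.
move=> /(_ R (nbhs (0:R)^'+)
  (fun d x => `[a, b]%classic x -> forall y, `[a, b]%classic y -> `|x - y| < d -> `|f x - f y| < e) _).
case.
  move=> x Kx; have [r r0 hr] := within_continuous_dist cf Kx (divr_gt0 e0 (ltr0n _ 2)).
  exists (ball x (r / 2), [set d | d < r / 2]); first split => /=.
  - by apply: nbhsx_ballx; rewrite divr_gt0.
  - by apply: nbhs_right_lt; rewrite divr_gt0.
  - move=> [x' d] /= [xx' dr] Kx' y Ky x'y.
    have h1 : `|f x - f x'| < e / 2 by apply: hr => //; move: xx'; rewrite /ball/=; lra.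
    have h2 : `|f x - f y| < e / 2.
      apply: hr => //; rewrite (le_lt_trans (ler_distD x' _ _))//.
      by move: xx'; rewrite /ball/=; lra.
    by rewrite (le_lt_trans (ler_distD (f x) _ _))// [`|f x' - _|]distrC; lra.
move=> d /= d0 h; exists (d / 2); first by rewrite divr_gt0.
move=> x y xab yab xy; apply: (h (d / 2)) => //=.
- by rewrite sub0r normrN gtr0_norm ?divr_gt0//; lra.
- by rewrite divr_gt0.
Qed.

Lemma measurable_within_continuous (a b : R) (f : R -> R) :
  {within `[a, b], continuous f} ->
  measurable_fun (`[a, b]%classic : set (measurableTypeR R)) f.
Proof. by move=> cf; apply: subspace_continuous_measurable_fun => //; exact: measurable_itv. Qed.

Lemma bounded_within_continuous (a b : R) (f : R -> R) : a <= b ->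
  {within `[a, b], continuous f} ->
  exists2 C, 0 <= C & forall x, a <= x <= b -> `|f x| <= C.
Proof.
move=> ab cf; have cnf : {within `[a, b], continuous (fun x => `|f x|)}.
  by move=> x; apply: continuous_comp; [exact: cf|exact: norm_continuous].
have [c _ hc] := EVT_max ab cnf.
by exists `|f c| => // x xab; apply: hc; rewrite in_itv.
Qed.

Lemma within_continuous_comp (A : set R) (f phi : R -> R) :
  {within A, continuous f} -> continuous phi ->
  {within A, continuous (fun x => phi (f x))}.
Proof. by move=> cf cphi x; apply: continuous_comp; [exact: cf|exact: cphi]. Qed.

Lemma Rintegral_sub_0 L f x y : mu.-integrable `[0, L]%classic (EFin \o f) ->
  0 <= x -> x <= y -> y <= L ->
  Rintegral mu `[0, y]%classic f - Rintegral mu `[0, x]%classic f =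
  Rintegral mu `]x, y]%classic f.
Proof.
move=> fi x0 xy yL; apply: Rintegral_itvB; last 2 first.
- by rewrite bnd_simp.
- by rewrite bnd_simp.
by apply: integrableS fi => //; apply: subset_itvl; rewrite bnd_simp.
Qed.

Lemma integrable_sub_oc L f x y : mu.-integrable `[0, L]%classic (EFin \o f) ->
  0 <= x -> y <= L -> mu.-integrable `]x, y]%classic (EFin \o f).
Proof.
move=> fi x0 yL; apply: integrableS fi => //.
by apply: subset_itv; rewrite bnd_simp.
Qed.

Lemma integrable_sub_0 L f x : mu.-integrable `[0, L]%classic (EFin \o f) ->
  x <= L -> mu.-integrable `[0, x]%classic (EFin \o f).
Proof.
by move=> fi xL; apply: integrableS fi => //; apply: subset_itvl; rewrite bnd_simp.
Qed.

(** Integrands with a common majorant [g] have primitives with a common modulus of continuity,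
    namely the primitive of [g]; this is the source of equicontinuity below. *)
Lemma primitive_dist_le L f g x y : mu.-integrable `[0, L]%classic (EFin \o f) ->
  mu.-integrable `[0, L]%classic (EFin \o g) ->
  (forall t, 0 <= t <= L -> `|f t| <= g t) ->
  0 <= x -> x <= y -> y <= L ->
  `|Rintegral mu `[0, y]%classic f - Rintegral mu `[0, x]%classic f| <=
  Rintegral mu `[0, y]%classic g - Rintegral mu `[0, x]%classic g.
Proof.
move=> fi gi fg x0 xy yL; rewrite (Rintegral_sub_0 fi)// (Rintegral_sub_0 gi)//.
have fi' := integrable_sub_oc fi x0 yL; have gi' := integrable_sub_oc gi x0 yL.
apply: (le_trans (le_normr_Rintegral _ _)) => //.
apply: le_Rintegral => //; first exact: integrable_EFin_norm.
move=> t /=; rewrite in_itv/= => /andP[xt ty]; apply: fg.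
by rewrite (le_trans x0 (ltW xt)) (le_trans ty yL).
Qed.

Lemma Rintegral_00 f : Rintegral mu `[0, 0]%classic f = 0.
Proof. by rewrite set_itv1 Rintegral_set1. Qed.

Lemma primitive_continuous L f : 0 <= L ->
  mu.-integrable `[0, L]%classic (EFin \o f) ->
  {within `[0, L], continuous (fun x => Rintegral mu `[0, x]%classic f)}.
Proof. by move=> L0 fi; exact: parameterized_integral_continuous. Qed.

Lemma eq_within_continuous (a b : R) (f g : R -> R) :
  (forall x, a <= x <= b -> f x = g x) ->
  {within `[a, b], continuous f} -> {within `[a, b], continuous g}.
Proof.
move=> fg; apply: subspace_eq_continuous => x; rewrite inE/= in_itv/=.
exact: fg.
Qed.

Lemma H10_continuous L u du : 0 <= L -> H10 L u du -> {within `[0, L], continuous u}.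
Proof.
move=> L0 [/L2_integrable dui [uE _]].
apply: eq_within_continuous (primitive_continuous L0 dui).
by move=> x /uE ->.
Qed.

Lemma exists_mesh_lt L d : 0 <= L -> 0 < d -> exists N : nat, L / N.+1%:R < d.
Proof.
move=> L0 d0; exists (Num.bound (L / d)).
rewrite ltr_pdivrMr// mulrC -ltr_pdivrMr//.
by have := archi_boundP (divr_ge0 L0 (ltW d0)); rewrite -natr1; lra.
Qed.

(** Cut [[0, L]] into cells shorter than [d] and telescope. The increments of [V] add up exactly, so
    the factor [e] does not grow with the number of cells. *)
Lemma local_increment_le L d e (F V : R -> R) : 0 <= L -> 0 < d ->
  (forall x y, 0 <= x -> x <= y -> y <= L -> y - x < d ->
     `|F y - F x| <= e * (V y - V x)) ->
  `|F L - F 0| <= e * (V L - V 0).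
Proof.
move=> L0 d0 h.
have [N hN] := exists_mesh_lt L0 d0.
pose p i : R := i%:R * (L / N.+1%:R).
have pS i : p i.+1 = p i + L / N.+1%:R by rewrite /p -natr1; ring.
have LN0 : 0 <= L / N.+1%:R by rewrite divr_ge0.
have p0 i : 0 <= p i by rewrite mulr_ge0.
have pN : p N.+1 = L by rewrite /p; field.
have pL i : (i <= N.+1)%N -> p i <= L.
  by move=> iN; rewrite -[leRHS]pN /p ler_wpM2r// ler_nat.
have claim i : (i <= N.+1)%N -> `|F (p i) - F 0| <= e * (V (p i) - V 0).
  elim: i => [_|i IH iN]; first by rewrite /p mul0r !subrr mulr0 normr0.
  rewrite (le_trans (ler_distD (F (p i)) _ _))//.
  have := IH (ltnW iN).
  have : `|F (p i.+1) - F (p i)| <= e * (V (p i.+1) - V (p i)).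
    apply: h; [exact: p0| |exact: pL|]; rewrite pS; first by rewrite lerDl.
    by rewrite addrAC subrr add0r.
  by rewrite !mulrBr; lra.
by have := claim N.+1 (leqnn _); rewrite pN.
Qed.


(** Mean value theorem for a primitive of [phi]. Locating [xi] by its distance to [s], not by order,
    gives one statement for both orders of [s] and [t]. *)
Lemma antiderivative_increment (phi : R -> R) (M : R) : continuous phi -> 0 <= M ->
  exists Phi : R -> R, forall s t, `|s| <= M -> `|t| <= M ->
  exists2 xi, `|xi| <= M /\ `|xi - s| <= `|t - s| &
    Phi t - Phi s = phi xi * (t - s).
Proof.
move=> cphi M0.
(* The margin [1] on either side makes all of $[-M,M]$ interior, so that [Phi] has derivative [phi]
   at the endpoints too. *)
pose Phi x := Rintegral mu `[- M - 1, x]%classic phi; exists Phi.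
have intphi : mu.-integrable `[- M - 1, M + 1]%classic (EFin \o phi).
  apply: continuous_compact_integrable; first exact: segment_compact.
  exact: continuous_subspaceT.
have dPhi x : - M - 1 < x < M + 1 -> derivable Phi x 1 /\ derive1 Phi x = phi x.
  move=> /andP[x1 x2].
  exact: (@continuous_FTC1_closed _ phi (- M - 1) x (M + 1) x2 intphi x1 (cphi x)).
have isd x : - M - 1 < x < M + 1 -> is_derive x 1 Phi (phi x).
  move=> /dPhi[dx <-]; rewrite derive1E; exact: derivableP.
have main s t : s <= t -> `|s| <= M -> `|t| <= M ->
   exists2 xi, s <= xi <= t & Phi t - Phi s = phi xi * (t - s).
  rewrite !ler_norml => st /andP[s1 s2] /andP[t1 t2].
  have [||xi] := @MVT_segment R Phi phi s t st.
  - by move=> x; rewrite in_itv/= => /andP[x1 x2]; apply: isd; lra.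
  - apply: derivable_within_continuous => x; rewrite in_itv/= => /andP[x1 x2].
    by have [] := dPhi x; first lra.
  by rewrite in_itv/= => hxi E; exists xi.
move=> s t sM tM; have [st|/ltW ts] := leP s t.
  have [xi /andP[x1 x2] E] := main s t st sM tM; exists xi => //.
  move: sM tM; rewrite !ler_norml => /andP[? ?] /andP[? ?]; split; first lra.
  by rewrite !ger0_norm; lra.
have [xi /andP[x1 x2] E] := main t s ts tM sM; exists xi.
  move: sM tM; rewrite !ler_norml => /andP[? ?] /andP[? ?]; split; first lra.
  by rewrite !ler0_norm; lra.
by rewrite -opprB E -mulrN opprB.
Qed.

(* Mean value theorem for a primitive of [phi], on a mesh so fine that [phi \o u]
   oscillates by less than [e] on each cell: no a.e. derivative of [u] is needed. *)
Lemma H10_Rintegral_comp_deriv L u du (phi : R -> R) : 0 <= L -> H10 L u du ->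
  continuous phi ->
  Rintegral mu `[0, L]%classic (fun x => phi (u x) * du x) = 0.
Proof.
move=> L0 Hu cphi; have [Ldu [uE uL]] := Hu.
have dui := L2_integrable Ldu.
have cu := H10_continuous L0 Hu.
have [M M0 uM] := bounded_within_continuous L0 cu.
have [Phi hPhi] := antiderivative_increment cphi M0.
have cw := within_continuous_comp cu cphi.
have mw := measurable_within_continuous cw.
have [C C0 wC] := bounded_within_continuous L0 cw.
have Lw : L2 L (fun x => phi (u x)).
  apply: (@L2_bounded _ _ C) => // x /=; rewrite in_itv/=; exact: wC.
have wi := L2M_integrable Lw Ldu.
have ni := integrable_EFin_norm dui.
set W := Rintegral _ _ _.
have u0 : u 0 = 0 by rewrite uE ?lexx// Rintegral_00.
(* [F] is the defect of the chain rule. As [u] vanishes at both ends, [W] equals [F 0 - F L]; it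
   suffices that [F] moves by at most [e] times the variation [V], for every [e > 0]. *)
pose F x := Phi (u x) - Rintegral mu `[0, x]%classic (fun x => phi (u x) * du x).
pose V x := Rintegral mu `[0, x]%classic (fun x => `|du x|).
suff key e : 0 < e -> `|F L - F 0| <= e * (V L - V 0).
  have -> : W = - (F L - F 0).
    by rewrite /F uL u0 Rintegral_00 -/W; ring.
  have V0 : 0 <= V L - V 0.
    by rewrite {2}/V Rintegral_00 subr0; apply: Rintegral_ge0.
  apply/eqP; rewrite oppr_eq0 -normr_le0; apply/ler_addgt0Pr => e e0; rewrite add0r.
  (* The [+ 1] keeps the denominator positive when [du] vanishes a.e. *)
  have e1 : 0 < e / (V L - V 0 + 1) by rewrite divr_gt0//; lra.
  apply: (le_trans (key _ e1)); rewrite mulrAC ler_pdivrMr; last lra.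
  by rewrite ler_pM2l//; lra.
move=> e0.
have cphi' : {within `[- M, M], continuous phi} by exact: continuous_subspaceT.
have [eta eta0 heta] := within_unif_continuous cphi' e0.
have [d d0 hd] := within_unif_continuous cu (divr_gt0 eta0 (ltr0n _ 2)).
apply: (local_increment_le L0 d0) => x y x0 xy yL yx.
have xL : x <= L := le_trans xy yL; have y0 : 0 <= y := le_trans x0 xy.
have ux : `|u x| <= M by apply: uM; rewrite x0.
have uy : `|u y| <= M by apply: uM; rewrite y0.
have [xi [xiM xi1] E] := hPhi _ _ ux uy.
(* On a cell, [xi] and [u t] each lie within [eta / 2] of [u x], so [phi xi] and [phi (u t)] differ
   by less than [e]. *)
have -> : F y - F x = Rintegral mu `]x, y]%classic (fun t => phi xi * du t - phi (u t) * du t).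
  rewrite RintegralB//; last 2 first.
  - by apply: integrable_EFinZ => //; exact: integrable_sub_oc dui x0 yL.
  - exact: integrable_sub_oc wi x0 yL.
  rewrite RintegralZl//; last exact: integrable_sub_oc dui x0 yL.
  rewrite -(Rintegral_sub_0 dui)// -(Rintegral_sub_0 wi)// -!uE ?x0 ?y0//.
  by rewrite -E /F; ring.
rewrite (Rintegral_sub_0 ni)//.
have ni' := integrable_sub_oc ni x0 yL.
rewrite -RintegralZl//.
have Ii : mu.-integrable `]x, y]%classic (EFin \o (fun t => phi xi * du t - phi (u t) * du t)).
  apply: integrable_EFinB => //.
    by apply: integrable_EFinZ => //; exact: integrable_sub_oc dui x0 yL.
  exact: integrable_sub_oc wi x0 yL.
apply: (le_trans (le_normr_Rintegral _ _)) => //.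
apply: le_Rintegral => //.
- exact: integrable_EFin_norm.
- exact: integrable_EFinZ.
move=> t /=; rewrite in_itv/= => /andP[xt ty].
rewrite -mulrBl normrM ler_wpM2r// ltW// heta//.
- by rewrite -ler_norml.
- by rewrite -ler_norml; apply: uM; rewrite (le_trans x0 (ltW xt)) (le_trans ty yL).
- have h1 : `|u x - u y| < eta / 2.
    by apply: hd; rewrite ?x0 ?y0// distrC ger0_norm//; lra.
  have h2 : `|u x - u t| < eta / 2.
    apply: hd; rewrite ?x0//; first by rewrite (le_trans x0 (ltW xt)) (le_trans ty yL).
    by rewrite distrC ger0_norm; lra.
  rewrite (le_lt_trans (ler_distD (u x) _ _))//.
  by move: xi1; rewrite [`|u y - _|]distrC; lra.
Qed.

Lemma comp_H10_L2 L u du phi : 0 <= L -> H10 L u du -> continuous phi ->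
  L2 L (fun x => phi (u x)).
Proof.
move=> L0 Hu cphi; have cu := within_continuous_comp (H10_continuous L0 Hu) cphi.
have [M M0 uM] := bounded_within_continuous L0 cu.
apply: (@L2_bounded _ _ M); first exact: measurable_within_continuous.
by move=> x /=; rewrite in_itv/=; exact: uM.
Qed.

Lemma energy_estimate L (alpha beta : R) (a g phi u du : R -> R) : 0 <= L -> 0 < alpha ->
  measurable_fun `[0, L]%classic a -> ae_on L (fun x => alpha <= a x <= beta) ->
  L2 L g -> continuous phi -> H10 L u du -> approx_eq L a g phi u du ->
  L2norm L du <= L2norm L g / alpha.
Proof.
move=> L0 al0 ma aab Lg cphi Hu eq; have [Ldu _] := Hu.
have ab : {ae mu, forall x, `[0, L]%classic x -> `|a x| <= beta}.
  apply: (ae_imp _ (ae_on_cc aab)) => x h Dx; have /andP[h1 h2] := h Dx.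
  by rewrite ger0_norm//; lra.
have Ladu := L2_bndM ma ab Ldu.
have := eq _ _ Hu; rewrite H10_Rintegral_comp_deriv// add0r => E.
have h1 : alpha * L2norm L du ^+ 2 <= L2norm L g * L2norm L du.
  apply: (@le_trans _ _ (Rintegral mu `[0, L]%classic (fun x => a x * du x * du x))).
    rewrite sqr_L2norm -RintegralZl//; last exact: L2_integrable_sqr.
    apply: ae_le_Rintegral => //.
    - by apply: integrable_EFinZ => //; exact: L2_integrable_sqr.
    - exact: L2M_integrable.
    apply: (ae_imp _ (ae_on_cc aab)) => x h Dx; have /andP[h1 h2] := h Dx.
    by rewrite -mulrA -expr2 ler_wpM2r// sqr_ge0.
  by rewrite E (le_trans (ler_norm _))// Cauchy_Schwarz_L2.
rewrite ler_pdivlMr// mulrC.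
have [->|n0] := eqVneq (L2norm L du) 0; first by rewrite mulr0 L2norm_ge0.
have np : 0 < L2norm L du by rewrite lt_neqAle eq_sym n0 L2norm_ge0.
by move: h1; rewrite expr2 mulrA ler_pM2r.
Qed.

End Primitives.

(** * Dominated convergence and an Arzela-Ascoli argument *)

Section Convergence.
Local Set Implicit Arguments.
Local Unset Strict Implicit.
Context {R : realType}.
Local Notation mu := (@lebesgue_measure R).
Implicit Types (D E : set (measurableTypeR R)) (f g : R -> R) (L : R).

Lemma cvg_Rintegral_dominated D (f_ : nat -> R -> R) f g : measurable D ->
  (forall n, measurable_fun D (f_ n)) -> measurable_fun D f ->
  {ae mu, forall x, D x -> f_ n x @[n --> \oo] --> f x} ->
  mu.-integrable D (EFin \o g) ->
  {ae mu, forall x, D x -> forall n, `|f_ n x| <= g x} ->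
  Rintegral mu D (f_ n) @[n --> \oo] --> Rintegral mu D f.
Proof.
move=> mD mf_ mf fcvg gi fg.
have [] := @dominated_convergence _ _ R mu D mD (fun n => EFin \o f_ n) (EFin \o f) (EFin \o g).
- by move=> n; exact/measurable_EFinP.
- exact/measurable_EFinP.
- apply: (ae_imp _ fcvg) => x h Dx /=; apply: cvg_EFin; last exact: h.
  by apply: nearW.
- exact: gi.
- by apply: (ae_imp _ fg) => x h n Dx /=; rewrite lee_fin; exact: h.
move=> fi _ h; apply: fine_cvg; rewrite fineK; first exact: h.
exact: integrable_fin_num.
Qed.

(* Tychonoff gives a pointwise cluster point; the common modulus [G] turns closeness
   on a finite net into uniform closeness. The index [None] carries [c]. *)
Lemma equicontinuous_cluster L (G : R -> R) (F : nat -> R -> R) (c : nat -> R) (M C : R) :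
  0 <= L -> {within `[0, L], continuous G} ->
  (forall k x, 0 <= x <= L -> `|F k x| <= M) -> (forall k, `|c k| <= C) ->
  (forall k x y, 0 <= x -> x <= y -> y <= L -> `|F k y - F k x| <= G y - G x) ->
  exists p q, forall e n, 0 < e -> exists2 k, (n <= k)%N &
    `|c k - q| < e /\ forall x, 0 <= x <= L -> `|F k x - p x| < e.
Proof.
move=> L0 cG FM cC FG.
have C0 : 0 <= C := le_trans (normr_ge0 _) (cC 0%N).
have M0 : 0 <= M by apply: (le_trans (normr_ge0 (F 0%N 0))); apply: FM; rewrite lexx.
(* Outside [[0, L]] the coordinate is frozen at [0], so that every [H k] lies in a compact product
   of copies of $[-(M+C), M+C]$. *)
pose H k (o : option R) : R :=
  if o is Some x then (if 0 <= x <= L then F k x else 0) else c k.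
have comp : @compact (prod_topology (fun _ : option R => R^o))
    [set f | forall i, `[- (M + C), M + C]%classic (f i)].
  exact: (@tychonoff (option R) (fun=> R^o) (fun=> `[- (M + C), M + C]%classic)
    (fun=> @segment_compact R _ _)).
have HMC k i : `|H k i| <= M + C.
  rewrite /H; case: i => [x|]; last by rewrite (le_trans (cC k))// lerDr.
  have [xL|_] := boolP (0 <= x <= L); last by rewrite normr0 addr_ge0.
  by rewrite (le_trans (FM k x xL))// lerDl.
have [] := comp (H k @[k --> \oo]) _.
  by exists 0%N => // k _ i /=; rewrite in_itv/= -ler_norml; exact: HMC.
move=> P [_ clP].
(* A cluster point for the product topology is approached, at any finitely many coordinates, by
   arbitrarily late terms. *)
have near_pts (s : seq (option R)) e n : 0 < e ->
    exists2 k, (n <= k)%N & forall i, i \in s -> `|H k i - P i| < e.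
  move=> e0.
  have : (H k @[k --> \oo]) [set f | exists2 k, (n <= k)%N & f = H k].
    by exists n => // k /= nk; exists k.
  have : nbhs (P : prod_topology (fun _ : option R => R^o))
      [set f | forall i, i \in s -> `|f i - P i| < e].
    elim: s => [|i s IH].
      have -> : [set f : option R -> R | forall i, i \in [::] -> `|f i - P i| < e] = setT.
        by apply/seteqP; split.
      exact: (@filterT _ (nbhs (P : prod_topology (fun _ : option R => R^o))) _).
    have Hi : nbhs (P : prod_topology (fun _ : option R => R^o))
        [set f | ball (P i : R^o) e (f i)].
      exact: (@proj_continuous (option R) (fun _ => R^o) i P _ (nbhsx_ballx (P i : R^o) e e0)).
    apply: (@filterS _ (nbhs (P : prod_topology (fun _ : option R => R^o))) _ _ _ _
      (@filterI _ (nbhs (P : prod_topology (fun _ : option R => R^o))) _ _ _ IH Hi))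
      => f [h1 h2] j.
    rewrite inE => /predU1P[->|]; last exact: h1.
    by rewrite distrC.
  move=> nP /clP /(_ nP)[_ [[k nk ->] h]].
  by exists k.
pose p x := P (Some x).
have pG x y e : 0 <= x -> x <= y -> y <= L -> 0 < e -> `|p y - p x| <= G y - G x + e.
  move=> x0 xy yL e0.
  have [k _ hk] := near_pts [:: Some x; Some y] (e / 2) 0%N (divr_gt0 e0 (ltr0n _ 2)).
  have := hk (Some x); have := hk (Some y); rewrite !inE !eqxx orbT/= x0 yL.
  rewrite (le_trans xy yL) (le_trans x0 xy)/= => /(_ isT) h1 /(_ isT) h2.
  have := FG k x y x0 xy yL.
  have -> : p y - p x = - (F k y - P (Some y)) + (F k y - F k x) + (F k x - P (Some x)).
    by rewrite /p; ring.
  move=> h3; rewrite (le_trans (ler_normD _ _))// (le_trans (lerD (ler_normD _ _) (lexx _)))//.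
  by rewrite normrN; lra.
exists p, (P None) => e n e0.
(* The four quarters of [e] go to the modulus of [F k], to closeness at a net point, and twice to
   the modulus of [p], which is known only up to an extra [e / 4]. *)
have [d d0 hd] := within_unif_continuous cG (divr_gt0 e0 (ltr0n _ 4)).
have [N hN] := exists_mesh_lt L0 d0.
pose z i : R := i%:R * (L / N.+1%:R).
have zS i : z i.+1 = z i + L / N.+1%:R by rewrite /z -natr1; ring.
have LN0 : 0 <= L / N.+1%:R by rewrite divr_ge0.
have z0 i : 0 <= z i by rewrite mulr_ge0.
have zN : z N.+1 = L by rewrite /z; field.
have net j x : 0 <= x <= z j -> exists2 i, (i <= j)%N & z i <= x /\ x - z i < d.
  elim: j => [|j IH] /andP[x0 xj].
    exists 0%N => //; rewrite /z mul0r subr0; split => //.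
    by move: xj; rewrite /z mul0r; lra.
  have [xz|zx] := leP x (z j).
    by have [|i ij h] := IH; [rewrite x0|exists i => //; rewrite ltnW].
  exists j => //; split; first exact: ltW.
  by move: xj; rewrite zS => xj; apply: le_lt_trans hN; rewrite lerBlDl.
have [k nk hk] := near_pts (None :: [seq Some (z i) | i <- iota 0 N.+2]) (e / 4) n
  (divr_gt0 e0 (ltr0n _ 4)).
exists k => //; split.
  by have := hk None; rewrite inE eqxx => /(_ isT) /=; lra.
move=> x /andP[x0 xL]; have [|i iN [zx xz]] := net N.+1 x; first by rewrite x0 zN.
have zL : z i <= L := le_trans zx xL.
have : `|H k (Some (z i)) - P (Some (z i))| < e / 4.
  apply: hk; rewrite inE; apply/orP; right.
  by apply: (map_f (fun i => Some (z i))); rewrite mem_iota/= add0n ltnS.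
rewrite /= z0 zL/= => h1.
have h2 := FG k _ _ (z0 i) zx xL.
have h3 := pG _ _ (e / 4) (z0 i) zx xL (divr_gt0 e0 (ltr0n _ 4)).
have h4 : G x - G (z i) < e / 4.
  apply: le_lt_trans (ler_norm _) _; apply: hd; rewrite ?x0 ?z0//.
  by rewrite ger0_norm// subr_ge0.
have -> : F k x - p x = (F k x - F k (z i)) + (F k (z i) - P (Some (z i))) - (p x - p (z i)).
  by rewrite /p; ring.
rewrite (le_lt_trans (ler_normB _ _))// (le_lt_trans (lerD (ler_normD _ _) (lexx _)))//.
lra.
Qed.

End Convergence.

(** * The delayed equation: method of steps, shooting, removal of the delay *)

Section DelayedEquation.
Local Set Implicit Arguments.
Local Unset Strict Implicit.
Context {R : realType}.
Local Notation mu := (@lebesgue_measure R).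
Context (L m K B : R) (b g phi : R -> R).
Hypotheses (L0 : 0 < L) (m0 : 0 < m)
  (mb : measurable_fun `[0, L]%classic b) (bb : forall x, m <= b x <= K)
  (Lg : L2 L g) (cphi : continuous phi) (phiB : forall s, `|phi s| <= B).
Implicit Types (h c x t : R) (v : R -> R).

(** Here [b] plays the role of $1/a$. The maximum with [0] extends [v] to negative times by its
    value at [0]. *)
Definition delayed_rhs h c v t := b t * (phi (v (Num.max 0 (t - h))) + g t + c).

Definition delayed_step h c v x := Rintegral mu `[0, x]%classic (delayed_rhs h c v).

Definition delayed_iter h c n := iter n (delayed_step h c) (fun _ => 0).

(** Majorant of [delayed_rhs h c v], uniform in [h], in [v] and in all [c] with [|c| <= C]. *)
Definition rhs_bound C t := K * (B + `|g t| + C).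

Lemma rhs_bound_integrable C :
  mu.-integrable `[0, L]%classic (EFin \o rhs_bound C).
Proof.
apply: integrable_EFinZ => //; apply: integrable_EFinD => //; last exact: integrable_cst_0L.
apply: integrable_EFinD => //; first exact: integrable_cst_0L.
by apply: integrable_EFin_norm; exact: L2_integrable.
Qed.

Lemma delayed_rhs_le h c v t C : `|c| <= C -> `|delayed_rhs h c v t| <= rhs_bound C t.
Proof.
move=> cC; rewrite /delayed_rhs /rhs_bound normrM.
have /andP[b1 b2] := bb t; have m_gt0 := m0.
apply: ler_pM => //; first by rewrite ger0_norm//; lra.
rewrite (le_trans (ler_normD _ _))//; apply: lerD => //.
by rewrite (le_trans (ler_normD _ _))//; exact: lerD.
Qed.

Lemma measurable_delayed_rhs h c v : 0 <= h -> {within `[0, L], continuous v} ->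
  measurable_fun (`[0, L]%classic : set (measurableTypeR R)) (delayed_rhs h c v).
Proof.
move=> h0 cv; have [mg _] := Lg.
apply: measurable_funM => //; apply: measurable_funD => //; apply: measurable_funD => //.
have mphi := measurable_within_continuous (within_continuous_comp cv cphi).
apply: (@measurable_comp _ _ _ _ _ _ (`[0, L]%classic : set (measurableTypeR R))
  (fun s => phi (v s)) _ (fun t => Num.max 0 (t - h))) => //.
  move=> _ [t /= + <-]; rewrite !in_itv/= => /andP[t0 tL].
  by rewrite le_max lexx/= ge_max ltW//=; lra.
apply: measurable_maxr => //.
by apply: measurable_funB.
Qed.

Lemma delayed_rhs_integrable h c v : 0 <= h -> {within `[0, L], continuous v} ->
  mu.-integrable `[0, L]%classic (EFin \o delayed_rhs h c v).
Proof.
move=> h0 cv; apply: (integrable_EFin_dom _ _ _ (rhs_bound_integrable `|c|)) => //.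
  exact: measurable_delayed_rhs.
by move=> t _; exact: delayed_rhs_le.
Qed.

Lemma delayed_iter_continuous h c n : 0 <= h ->
  {within `[0, L], continuous (delayed_iter h c n)}.
Proof.
move=> h0; elim: n => [|n IH]; first by move=> x; exact: cst_continuous.
by apply: primitive_continuous; [exact: ltW|exact: delayed_rhs_integrable].
Qed.

(** Method of steps: on $[0,(n+1)h]$ the next iterate reads its predecessor only at arguments in
    $[0,nh]$, where the iteration has already stabilised. Finitely many iterations thus give an
    exact solution. *)
Lemma delayed_iter_stable h c n x : 0 <= h -> 0 <= x <= L -> x <= n%:R * h ->
  delayed_iter h c n.+1 x = delayed_iter h c n x.
Proof.
move=> h0; elim: n x => [|n IH] x /andP[x0 xL].
  rewrite mul0r => xle0; have -> : x = 0 by apply/le_anti; rewrite x0 xle0.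
  by rewrite /delayed_iter/= /delayed_step Rintegral_00.
rewrite -natr1 mulrDl mul1r => xn.
apply: eq_Rintegral => t; rewrite inE/= in_itv/= => /andP[t0 tx].
have := IH (Num.max 0 (t - h)); rewrite /delayed_rhs => /= ->//.
  by rewrite le_max lexx/= ge_max (le_trans x0 xL)/=; lra.
by rewrite ge_max mulr_ge0//=; lra.
Qed.

(** Continuity under the integral sign, with the majorant belonging to [|c| <= |c0| + 1]; the
    induction hypothesis is applied at the delayed argument and carried through [phi]. *)
Lemma delayed_iter_continuous_param h n x : 0 <= h -> 0 <= x <= L ->
  continuous (fun c => delayed_iter h c n x).
Proof.
move=> h0; elim: n x => [|n IH] x /andP[x0 xL]; first exact: cst_continuous.
move=> c0.
have xsub : `[0, x]%classic `<=` `[0, L]%classic.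
  by apply: subset_itvl; rewrite bnd_simp.
apply: (@continuity_under_integral R _ _ mu
  (fun c => delayed_rhs h c (delayed_iter h c n)) `[0, x]%classic _ (c0 - 1) (c0 + 1)
   _ _ (rhs_bound (`|c0| + 1))) => //.
- move=> c _; apply: integrable_sub_0 xL.
  by apply: delayed_rhs_integrable => //; exact: delayed_iter_continuous.
- apply: aeW => y Dy c _.
  have /andP[y0 yx] : 0 <= y <= x by move: Dy; rewrite /= in_itv.
  apply: cvgM; first exact: cvg_cst.
  apply: cvgD; last exact: cvg_id.
  apply: cvgD; last exact: cvg_cst.
  have IHy : continuous (fun c => delayed_iter h c n (Num.max 0 (y - h))).
    by apply: IH; rewrite le_max lexx/= ge_max (le_trans x0 xL)/=; lra.
  exact (continuous_cvg _ (@cphi _) (IHy c)).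
- by apply: integrable_sub_0 xL; exact: rhs_bound_integrable.
- move=> c /=; rewrite in_itv/= => /andP[c1 c2]; apply: aeW => y _.
  apply: delayed_rhs_le; rewrite -lerBlDl (le_trans (lerB_dist _ _))//.
  by rewrite ler_norml; lra.
- by rewrite inE/= in_itv/=; lra.
Qed.

(** The terminal value is $c\int b$ plus an integral bounded by that of [rhs_bound 0], and $\int b
    \ge mL$. Hence it is nonpositive at [- C] and nonnegative at [C], where [C] does not depend on
    [h]. *)
Lemma delayed_shooting h : 0 < h ->
  let C := Rintegral mu `[0, L]%classic (rhs_bound 0) / (m * L) in
  exists (u : R -> R) (c : R), [/\ {within `[0, L], continuous u}, `|c| <= C, u L = 0 &
    forall x, 0 <= x <= L -> u x = Rintegral mu `[0, x]%classic (delayed_rhs h c u)].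
Proof.
move=> h0 C; have h0' := ltW h0; have L0' := ltW L0.
pose N := Num.bound (L / h).
have LN : L <= N%:R * h.
  by rewrite -ler_pdivrMr// ltW// archi_boundP// divr_ge0.
have m_gt0 := m0; have K0 : 0 <= K by have /andP[] := bb 0; lra.
have B0 : 0 <= B := le_trans (normr_ge0 _) (phiB 0).
have S0 : 0 <= Rintegral mu `[0, L]%classic (rhs_bound 0).
  apply: Rintegral_ge0 => x _; rewrite /rhs_bound mulr_ge0// addr0 addr_ge0//.
have mL : 0 < m * L by rewrite mulr_gt0.
have C0 : 0 <= C by rewrite divr_ge0// ltW.
(* [N] iterations already reach [L]; one more exposes the terminal value as an integral in which [c]
   enters linearly, apart from its bounded influence through the previous iterate. *)
pose W c := delayed_iter h c N.+1 L.
have cW : continuous W by apply: delayed_iter_continuous_param => //; rewrite L0' lexx.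
have WE c : W c = Rintegral mu `[0, L]%classic (delayed_rhs h 0 (delayed_iter h c N)) +
   c * Rintegral mu `[0, L]%classic b.
  have ib : mu.-integrable `[0, L]%classic (EFin \o b).
    apply: (integrable_EFin_dom _ _ _ (integrable_cst_0L L K)) => // t _.
    by have /andP[] := bb t => ? ?; rewrite ger0_norm; lra.
  rewrite -RintegralZl// -RintegralD//.
  - by apply: eq_Rintegral => t _; rewrite /delayed_rhs; ring.
  - by apply: delayed_rhs_integrable => //; exact: delayed_iter_continuous.
  - exact: integrable_EFinZ.
have W1 c : `|Rintegral mu `[0, L]%classic (delayed_rhs h 0 (delayed_iter h c N))| <=
    Rintegral mu `[0, L]%classic (rhs_bound 0).
  have ii : mu.-integrable `[0, L]%classic (EFin \o delayed_rhs h 0 (delayed_iter h c N)).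
    by apply: delayed_rhs_integrable => //; exact: delayed_iter_continuous.
  apply: (le_trans (le_normr_Rintegral _ _)) => //.
  apply: le_Rintegral => //.
  - exact: integrable_EFin_norm.
  - exact: rhs_bound_integrable.
  - by move=> t _; apply: delayed_rhs_le; rewrite normr0.
have W2 : m * L <= Rintegral mu `[0, L]%classic b.
  rewrite -(Rintegral_cst_0L _ L0'); apply: le_Rintegral => //.
  - exact: integrable_cst_0L.
  - apply: (integrable_EFin_dom _ _ _ (integrable_cst_0L L K)) => // t _.
    by have /andP[] := bb t => ? ?; rewrite ger0_norm; lra.
  - by move=> t _; have /andP[] := bb t.
have CmL : C * (m * L) = Rintegral mu `[0, L]%classic (rhs_bound 0).
  by rewrite /C divfK// gt_eqF.
clearbody C.
have CW : Rintegral mu `[0, L]%classic (rhs_bound 0) <= C * Rintegral mu `[0, L]%classic b.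
  by rewrite -CmL ler_wpM2l.
have [|||c] := @IVT R W (- C) C 0.
- lra.
- exact: continuous_subspaceT.
- rewrite ge_min le_max !WE; apply/andP; split; apply/orP; [left|right].
    rewrite mulNr subr_le0; have := W1 (- C); rewrite ler_norml => /andP[_ hW].
    exact: le_trans hW CW.
  have := W1 C; rewrite ler_norml => /andP[hW _].
  by have := lerD hW CW; rewrite addNr.
rewrite in_itv/= -ler_norml => cC Wc0.
exists (delayed_iter h c N.+1), c; split; [exact: delayed_iter_continuous|exact: cC|exact: Wc0|].
move=> x /andP[x0 xL]; rewrite -(delayed_iter_stable c (n := N.+1))// ?x0//.
by rewrite (le_trans xL)// (le_trans LN)// ler_wpM2r// ler_nat.
Qed.

Lemma bounded_nonlinearity_solution :
  exists (u : R -> R) (c : R), [/\ {within `[0, L], continuous u}, u L = 0 &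
    forall x, 0 <= x <= L -> u x = Rintegral mu `[0, x]%classic
      (fun t => b t * (phi (u t) + g t + c))].
Proof.
have L0' := ltW L0.
have hk (k : nat) : 0 < k.+1%:R^-1 :> R by rewrite invr_gt0.
have /= := fun k => delayed_shooting (hk k).
set C := _ / (m * L) => H.
have /choice[F HF] : forall k : nat, exists uc : (R -> R) * R,
    [/\ {within `[0, L], continuous uc.1}, `|uc.2| <= C, uc.1 L = 0 &
    forall x, 0 <= x <= L -> uc.1 x = Rintegral mu `[0, x]%classic (delayed_rhs k.+1%:R^-1 uc.2 uc.1)].
  by move=> k; have [u [c h]] := H k; exists (u, c).
pose G x := Rintegral mu `[0, x]%classic (rhs_bound C).
have iG := rhs_bound_integrable C.
have cG : {within `[0, L], continuous G} by exact: primitive_continuous.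
have FG k x y : 0 <= x -> x <= y -> y <= L -> `|(F k).1 y - (F k).1 x| <= G y - G x.
  move=> x0 xy yL; have [cF cC FL FE] := HF k.
  rewrite !FE ?x0 ?(le_trans x0 xy) ?(le_trans xy yL)//.
  apply: (primitive_dist_le (L := L)) => //.
  - by apply: delayed_rhs_integrable => //; exact: ltW.
  - by move=> t _; exact: delayed_rhs_le.
have F0 k : (F k).1 0 = 0.
  by have [_ _ _ ->] := HF k; rewrite ?lexx ?L0' ?Rintegral_00.
have FM k x : 0 <= x <= L -> `|(F k).1 x| <= G L.
  move=> /andP[x0 xL]; have := FG k 0 x (lexx _) x0 xL.
  rewrite F0 subr0 => h; apply: (le_trans h).
  have := FG k x L x0 xL (lexx _); have := normr_ge0 ((F k).1 L - (F k).1 x).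
  have -> : G 0 = 0 by exact: Rintegral_00.
  lra.
have cC k : `|(F k).2| <= C by have [] := HF k.
have [p [q hpq]] := equicontinuous_cluster L0' cG FM cC FG.
(* The bound [n <= s n] is what sends the delays along [s] to [0]. *)
have /choice[s hs] : forall n : nat, exists k, (n <= k)%N /\
    (`|(F k).2 - q| < n.+1%:R^-1 /\ forall x, 0 <= x <= L -> `|(F k).1 x - p x| < n.+1%:R^-1).
  by move=> n; have [k h1 h2] := hpq _ n (hk n); exists k.
have inv0 : (n.+1%:R^-1 : R) @[n --> \oo] --> (0 : R) by exact: cvg_harmonic.
have cvc : (F (s n)).2 @[n --> \oo] --> q.
  apply/cvgrPdist_lt => e e0; have /cvgrPdist_lt/(_ e e0) := inv0.
  apply: filterS => n; rewrite sub0r normrN (gtr0_norm (hk n)) => hn.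
  by rewrite distrC; have [_ [h _]] := hs n; exact: lt_trans hn.
have cvF x : 0 <= x <= L -> (F (s n)).1 x @[n --> \oo] --> p x.
  move=> xL; apply/cvgrPdist_lt => e e0; have /cvgrPdist_lt/(_ e e0) := inv0.
  apply: filterS => n; rewrite sub0r normrN (gtr0_norm (hk n)) => hn.
  by rewrite distrC; have [_ [_ h]] := hs n; exact: lt_trans (h x xL) hn.
(* The delayed argument is eventually within [d] of [x], and the common modulus [G] compares the two
   values uniformly in [n]. *)
have cvFd x : 0 <= x <= L ->
    (F (s n)).1 (Num.max 0 (x - (s n).+1%:R^-1)) @[n --> \oo] --> p x.
  move=> xL; have /andP[x0 xL'] := xL.
  apply/cvgrPdist_lt => e e0.
  have [d d0 hd] := within_unif_continuous cG (divr_gt0 e0 (ltr0n _ 2)).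
  have /cvgrPdist_lt/(_ _ (divr_gt0 e0 (ltr0n _ 2))) := cvF x xL.
  have /cvgrPdist_lt/(_ d d0) := inv0; apply: filterS2 => n.
  rewrite sub0r normrN (gtr0_norm (hk n)) => hn hF.
  set y := Num.max _ _.
  have sn : ((s n).+1%:R^-1 : R) <= n.+1%:R^-1.
    by rewrite lef_pV2 ?posrE// ler_nat ltnS; have [] := hs n.
  have hsn := hk (s n).
  have y0 : 0 <= y by rewrite le_max lexx.
  have yx : y <= x by rewrite ge_max x0/= gerBl ltW.
  have xy : x - y < d.
    have : x - (s n).+1%:R^-1 <= y by rewrite le_max lexx orbT.
    rewrite lerBlDr => xys; rewrite ltrBlDr (le_lt_trans xys)// addrC ltrD2r.
    exact: le_lt_trans sn hn.
  have h1 := FG (s n) y x y0 yx xL'.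
  have h2 : G x - G y < e / 2.
    apply: le_lt_trans (ler_norm _) _; apply: hd => //; first by rewrite y0 (le_trans yx xL').
    by rewrite ger0_norm// subr_ge0.
  rewrite (le_lt_trans (ler_distD ((F (s n)).1 x) _ _))//.
  by lra.
have pG x y : 0 <= x -> x <= y -> y <= L -> `|p y - p x| <= G y - G x.
  move=> x0 xy yL.
  have h : `|(F (s n)).1 y - (F (s n)).1 x| @[n --> \oo] --> `|p y - p x|.
    apply: cvg_norm; apply: cvgB; apply: cvF.
      by rewrite yL (le_trans x0 xy).
    by rewrite x0 (le_trans xy yL).
  rewrite -(cvg_lim (@norm_hausdorff _ _) h); apply: limr_le.
    by apply/cvg_ex; exists `|p y - p x|.
  by apply: nearW => n; exact: FG.
have cp : {within `[0, L], continuous p}.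
  apply/subspace_continuousP => x /=; rewrite in_itv/= => xL.
  apply/cvgrPdist_lt => e e0.
  have [d d0 hd] := within_unif_continuous cG e0.
  rewrite near_withinE; apply/nbhs_ballP; exists d => //= y xy; rewrite in_itv/= => yL.
  have /andP[x0 xL'] := xL; have /andP[y0 yL'] := yL.
  have := hd x y xL yL xy.
  have [xy'|/ltW yx] := leP x y.
    have := pG x y x0 xy' yL'.
    rewrite [`|p x - _|]distrC [`|G x - _|]distrC => h1 h2.
    by rewrite (le_lt_trans h1)// (le_lt_trans (ler_norm _)).
  by have := pG y x y0 yx xL' => h1 h2; rewrite (le_lt_trans h1)// (le_lt_trans (ler_norm _)).
have pE x : 0 <= x <= L -> p x = Rintegral mu `[0, x]%classic
      (fun t => b t * (phi (p t) + g t + q)).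
  move=> xL; have /andP[x0 xL'] := xL.
  have xsub : `[0, x]%classic `<=` `[0, L]%classic.
    by apply: subset_itvl; rewrite bnd_simp.
  have h1 : Rintegral mu `[0, x]%classic (delayed_rhs (s n).+1%:R^-1 (F (s n)).2 (F (s n)).1)
     @[n --> \oo] --> Rintegral mu `[0, x]%classic (fun t => b t * (phi (p t) + g t + q)).
    apply: (cvg_Rintegral_dominated (g := rhs_bound C)) => //.
    - move=> n; have [cF _ _ _] := HF (s n).
      apply: (@measurable_funS _ _ _ _ `[0, L]%classic) => //.
      by apply: measurable_delayed_rhs => //; exact: ltW.
    - apply: (@measurable_funS _ _ _ _ `[0, L]%classic) => //.
      (* With delay [0] the delayed integrand is the limit integrand on [[0, L]], since the maximum
         of [0] and [t] is [t] there. *)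
      have := @measurable_delayed_rhs 0 q p (lexx _) cp.
      apply: eq_measurable_fun => t; rewrite inE/= in_itv/= => /andP[t0 tL].
      by rewrite /delayed_rhs subr0 max_r.
    - apply: aeW => t /= /xsub /=; rewrite in_itv/= => tL.
      apply: cvgM; first exact: cvg_cst.
      apply: cvgD; last exact: cvc.
      apply: cvgD; last exact: cvg_cst.
      exact (continuous_cvg _ (@cphi _) (cvFd t tL)).
    - exact: integrable_sub_0 iG xL'.
    - by apply: aeW => t _ n; have [_ ? _ _] := HF (s n); exact: delayed_rhs_le.
  have h2 : (F (s n)).1 x @[n --> \oo] -->
      Rintegral mu `[0, x]%classic (fun t => b t * (phi (p t) + g t + q)).
    have -> : (fun n => (F (s n)).1 x) = fun n => Rintegral mu `[0, x]%classic
        (delayed_rhs (s n).+1%:R^-1 (F (s n)).2 (F (s n)).1).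
      by apply/funext => n; have [_ _ _ ->] := HF (s n).
    exact: h1.
  by rewrite -(cvg_lim (@norm_hausdorff _ _) (cvF x xL)) -(cvg_lim (@norm_hausdorff _ _) h2).
exists p, q; split => //.
have LL : 0 <= L <= L by rewrite L0' lexx.
rewrite -(cvg_lim (@norm_hausdorff _ _) (cvF L LL)).
rewrite (_ : (fun n => (F (s n)).1 L) = fun _ => 0) ?lim_cst//.
by apply/funext => n; have [_ _ -> _] := HF (s n).
Qed.

End DelayedEquation.

(** * Solvability for fixed [n], the integrated equation, and test functions *)

Section ApproximateProblem.
Local Set Implicit Arguments.
Local Unset Strict Implicit.
Context {R : realType}.
Local Notation mu := (@lebesgue_measure R).
Implicit Types (L x : R) (a g phi u du : R -> R).

(** Bound $|u(x)|$ by $\int |u'|$ and apply Cauchy-Schwarz against the constant [1], whose norm is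
    $\sqrt L$. *)
Lemma H10_sup_le L u du x : 0 <= L -> H10 L u du -> 0 <= x <= L ->
  `|u x| <= Num.sqrt L * L2norm L du.
Proof.
move=> L0 [Ldu [uE _]] xL; have /andP[x0 xL'] := xL.
have dui := L2_integrable Ldu; have ni := integrable_EFin_norm dui.
have h : `|u x| <= Rintegral mu `[0, L]%classic (fun t => `|du t|).
  have := primitive_dist_le dui ni (fun t _ => lexx _) (lexx 0) x0 xL'.
  rewrite !Rintegral_00 !subr0 -uE// => h; apply: (le_trans h).
  rewrite -subr_ge0 (Rintegral_sub_0 ni)//; exact: Rintegral_ge0.
apply: (le_trans h).
have := Cauchy_Schwarz_L2 (L2_norm Ldu) (L2_cst L 1).
rewrite [L2norm L (fun _ => 1)]/L2norm.
under [X in Num.sqrt X]eq_Rintegral do rewrite expr1n.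
rewrite Rintegral_cst_0L// mul1r.
rewrite (_ : L2norm L (fun x => `|du x|) = L2norm L du); last first.
  rewrite /L2norm; congr Num.sqrt; apply: eq_Rintegral => t _.
  by rewrite real_normK ?num_real.
rewrite mulrC; apply: le_trans; apply: le_trans (ler_norm _).
by under [X in _ <= X]eq_Rintegral do rewrite mulr1.
Qed.

Lemma H10_primitive L dz : L2 L dz -> Rintegral mu `[0, L]%classic dz = 0 ->
  H10 L (fun x => Rintegral mu `[0, x]%classic dz) dz.
Proof. by []. Qed.

(** Subtracting the mean turns an arbitrary $L^2$ function into the derivative of an admissible test
    function. *)
Lemma H10_mean L dz : 0 < L -> L2 L dz ->
  H10 L (fun x => Rintegral mu `[0, x]%classic
      (fun t => dz t - Rintegral mu `[0, L]%classic dz / L))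
    (fun t => dz t - Rintegral mu `[0, L]%classic dz / L).
Proof.
move=> L0 Lz; apply: H10_primitive; first by apply: L2B => //; exact: L2_cst.
rewrite RintegralB//; [|exact: L2_integrable|exact: integrable_cst_0L].
by rewrite Rintegral_cst_0L ?ltW// divfK ?subrr// gt_eqF.
Qed.

Lemma H10_Rintegral_deriv L u du : 0 <= L -> H10 L u du ->
  Rintegral mu `[0, L]%classic du = 0.
Proof. by move=> L0 [_ [uE uL]]; rewrite -uE ?uL// L0 lexx. Qed.

Lemma approx_problem_solvable L (alpha beta : R) a g phi : 0 < L -> 0 < alpha ->
  alpha <= beta -> measurable_fun `[0, L]%classic a ->
  ae_on L (fun x => alpha <= a x <= beta) -> L2 L g -> continuous phi ->
  exists u du, H10 L u du /\ approx_eq L a g phi u du.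
Proof.
move=> L0 al0 ab ma aab Lg cphi; have L0' := ltW L0.
(* The sup bound given by the energy estimate. It is the same for every continuous nonlinearity, so
   it confines the solution of the truncated problem to the range where [phiT] and [phi] agree. *)
pose M := Num.sqrt L * (L2norm L g / alpha).
have M0 : 0 <= M by rewrite mulr_ge0 ?sqrtr_ge0// divr_ge0 ?L2norm_ge0// ltW.
pose clip (lo hi s : R) := Num.max lo (Num.min s hi).
have clipP lo hi s : lo <= hi -> lo <= clip lo hi s <= hi.
  by move=> lh; rewrite /clip le_max lexx/= ge_max lh/= ge_min lexx orbT.
have clip_id lo hi s : lo <= s <= hi -> clip lo hi s = s.
  by move=> /andP[h1 h2]; rewrite /clip min_l// max_r.
have cclip lo hi : continuous (clip lo hi).
  move=> s; have h1 : {for s, continuous (fun s : R => Num.min s hi : R^o)}.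
    exact: (continuous_min (@cvg_id _ _) (@cst_continuous _ _ _ _)).
  exact: (continuous_max (@cst_continuous _ _ _ _) h1).
pose phiT s := phi (clip (- M) M s).
have cphiT : continuous phiT.
  by move=> s; exact (continuous_comp (@cclip _ _ s) (@cphi _)).
have MM : - M <= M by lra.
have cphi' : {within `[- M, M], continuous phi} by exact: continuous_subspaceT.
have [B B0 hB] := bounded_within_continuous MM cphi'.
have phiTB s : `|phiT s| <= B by apply: hB; exact: clipP.
(* [a] obeys its bounds only a.e.; clipping before inverting gives [b] pointwise bounds and changes
   nothing outside a null set. *)
pose invclip s := (clip alpha beta s)^-1.
have clip_gt0 s : 0 < clip alpha beta s by have /andP[] := clipP _ _ s ab; lra.
have cinv : continuous invclip.
  by move=> s; apply: cvgV; [rewrite gt_eqF|exact: cclip].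
pose b x := invclip (a x).
have mb : measurable_fun `[0, L]%classic b.
  by apply: measurableT_comp => //; exact: continuous_measurable_fun.
have beta0 : 0 < beta by lra.
have bb x : beta^-1 <= b x <= alpha^-1.
  have /andP[h1 h2] := clipP _ _ (a x) ab.
  by rewrite /b /invclip !lef_pV2 ?posrE// h1 h2.
have ib0 : 0 < beta^-1 by rewrite invr_gt0.
have [u [c [cu uL uE]]] := bounded_nonlinearity_solution L0 ib0 mb bb Lg cphiT phiTB.
pose du t := b t * (phiT (u t) + g t + c).
have LphiT : L2 L (fun t => phiT (u t)).
  apply: (@L2_bounded _ _ B) => //.
  by apply: measurable_within_continuous; exact: within_continuous_comp.
have Ls : L2 L (fun t => phiT (u t) + g t + c).
  by apply: L2D; [exact: L2D|exact: L2_cst].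
have Ldu : L2 L du.
  apply: (@L2_bndM _ _ alpha^-1) => //; apply: aeW => x _.
  by have /andP[h1 h2] := bb x; rewrite ger0_norm//; lra.
have Hu : H10 L u du by [].
have aB : {ae mu, forall x, `[0, L]%classic x -> `|a x| <= beta}.
  apply: (ae_imp _ (ae_on_cc aab)) => x h Dx; have /andP[h1 h2] := h Dx.
  by rewrite ger0_norm//; lra.
have Ladu := L2_bndM ma aB Ldu.
(* Almost everywhere [a x * b x = 1], and the term [c * dz x] integrates to [0] because [dz] is
   mean-free. *)
have eqT : approx_eq L a g phiT u du.
  move=> z dz Hz; have [Ldz _] := Hz.
  have iphi := L2M_integrable LphiT Ldz; have ig := L2M_integrable Lg Ldz.
  have -> : Rintegral mu `[0, L]%classic (fun x => a x * du x * dz x) =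
      Rintegral mu `[0, L]%classic (fun x => (phiT (u x) * dz x + g x * dz x) + c * dz x).
    apply: Rintegral_ae_eq => //.
    - exact: (integrable_EFin_measurable (L2M_integrable Ladu Ldz)).
    - apply: integrable_EFin_measurable; apply: integrable_EFinD => //.
        exact: integrable_EFinD.
      by apply: integrable_EFinZ => //; exact: L2_integrable.
    apply: (ae_imp _ (ae_on_cc aab)) => x h Dx; have := h Dx => axb.
    rewrite /du /b /invclip clip_id// mulrA divff; first by ring.
    by rewrite gt_eqF//; move: axb => /andP[]; lra.
  rewrite RintegralD//; last 2 first.
  - exact: integrable_EFinD.
  - by apply: integrable_EFinZ => //; exact: L2_integrable.
  rewrite RintegralD// RintegralZl//; last exact: L2_integrable.
  by rewrite (H10_Rintegral_deriv L0' Hz) mulr0 addr0.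
have en := energy_estimate L0' al0 ma aab Lg cphiT Hu eqT.
have uM x : 0 <= x <= L -> - M <= u x <= M.
  move=> xL; rewrite -ler_norml (le_trans (H10_sup_le L0' Hu xL))//.
  by rewrite ler_wpM2l// sqrtr_ge0.
exists u, du; split => // z dz Hz; rewrite (eqT _ _ Hz); congr (_ + _).
by apply: eq_Rintegral => x; rewrite inE/= in_itv/= => /uM ?; rewrite /phiT clip_id.
Qed.

Lemma Rintegral_sqr_eq0 L (f : R -> R) : L2 L f ->
  Rintegral mu `[0, L]%classic (fun x => f x ^+ 2) = 0 ->
  {ae mu, forall x, `[0, L]%classic x -> f x = 0}.
Proof.
move=> Lf f0; have fi := L2_integrable_sqr Lf; have /integrableP[mf _] := fi.
have mD : measurable (`[0, L]%classic : set (measurableTypeR R)) by [].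
have /(ae_eq_integral_abs _ mD mf) h :
    (\int[mu]_(x in `[0%R, L]%classic) `|(EFin \o (fun x => f x ^+ 2)%R) x| = 0)%E.
  rewrite (_ : (fun x => _) = EFin \o (fun x => f x ^+ 2)); last first.
    by apply/funext => x; rewrite gee0_abs// lee_fin sqr_ge0.
  rewrite -[LHS]fineK; last exact: integrable_fin_num.
  by move: f0; rewrite /Rintegral => ->.
apply: (ae_imp _ h) => x hx Dx; have /= := hx Dx => -[] /eqP.
by rewrite sqrf_eq0 => /eqP.
Qed.

(* Test with the primitive of the mean-free part of [a u' - g - phi(u)]. *)
Lemma approx_eq_flux L (beta : R) a g phi u du : 0 < L ->
  measurable_fun `[0, L]%classic a ->
  {ae mu, forall x, `[0, L]%classic x -> `|a x| <= beta} -> L2 L g -> continuous phi ->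
  H10 L u du -> approx_eq L a g phi u du ->
  exists m, {ae mu, forall x, `[0, L]%classic x -> phi (u x) = a x * du x - g x - m}.
Proof.
move=> L0 ma aB Lg cphi Hu eq; have L0' := ltW L0; have [Ldu _] := Hu.
have Ladu := L2_bndM ma aB Ldu; have Lphi := comp_H10_L2 L0' Hu cphi.
pose F x := a x * du x - g x - phi (u x).
have LF : L2 L F by apply: L2B => //; exact: L2B.
have Hz := H10_mean L0 LF; set m := _ / L in Hz; exists m.
have [Ldz _] := Hz.
set z := (fun x => Rintegral _ _ _) in Hz; set dz := (fun t => F t - m) in Hz Ldz.
(* This is the equation tested with [z]. As [dz] is mean-free, subtracting [m] from [F] does not
   change the integral, which is therefore that of [dz x ^+ 2]. *)
have E : Rintegral mu `[0, L]%classic (fun x => F x * dz x) = 0.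
  have := eq _ _ Hz => E.
  transitivity (Rintegral mu `[0, L]%classic (fun x => (a x * du x * dz x - g x * dz x) - phi (u x) * dz x)).
    by apply: eq_Rintegral => x _; rewrite /F; ring.
  have i1 := L2M_integrable Ladu Ldz; have i2 := L2M_integrable Lg Ldz.
  have i3 := L2M_integrable Lphi Ldz.
  rewrite RintegralB//; last exact: integrable_EFinB.
  by rewrite RintegralB// E; ring.
have dz2 : Rintegral mu `[0, L]%classic (fun x => dz x ^+ 2) = 0.
  transitivity (Rintegral mu `[0, L]%classic (fun x => F x * dz x - m * dz x)).
    by apply: eq_Rintegral => x _; rewrite /dz; ring.
  rewrite RintegralB//; last 2 first.
  - exact: L2M_integrable.
  - by apply: integrable_EFinZ => //; exact: L2_integrable.
  by rewrite E RintegralZl ?(H10_Rintegral_deriv L0' Hz) ?mulr0 ?subr0//; exact: L2_integrable.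
apply: (ae_imp _ (Rintegral_sqr_eq0 Ldz dz2)) => x h Dx.
by have := h Dx; rewrite /dz /F; lra.
Qed.

Lemma test_fun_H10 L (psi : R -> R) : 0 < L -> test_fun L psi ->
  H10 L psi (derive1 psi) /\
  exists2 C, 0 <= C & forall x, 0 <= x <= L -> `|derive1 psi x| <= C.
Proof.
move=> L0 [dpsi [c [d [c0 cd dL psi0]]]]; have L0' := ltW L0.
have d0 x : derivable psi x 1 := dpsi 0%N x.
have d1 x : derivable (derive1 psi) x 1 := dpsi 1%N x.
have c1 : continuous (derive1 psi).
  by move=> x; apply: differentiable_continuous; exact/derivable1_diffP.
have cpsi : continuous psi.
  by move=> x; apply: differentiable_continuous; exact/derivable1_diffP.
have cw : {within `[0, L], continuous (derive1 psi)} by exact: continuous_subspaceT.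
have [C C0 hC] := bounded_within_continuous L0' cw.
split; last by exists C.
split.
  apply: (@L2_bounded _ _ C); first exact: measurable_within_continuous.
  by move=> x /=; rewrite in_itv/=; exact: hC.
split; last by apply: psi0; right.
have p0 : psi 0 = 0 by apply: psi0; left.
move=> x /andP[]; rewrite le_eqVlt => /predU1P[<- _|x0 xL].
  by rewrite Rintegral_00.
have cpsix : {within `[0, x], continuous (derive1 psi)} by exact: continuous_subspaceT.
have LRpsi : derivable_oo_LRcontinuous psi 0 x.
  split; first by move=> y _; exact: d0.
    by apply: cvg_at_right_filter; exact: cpsi.
  by apply: cvg_at_left_filter; exact: cpsi.
have E := continuous_FTC2 x0 cpsix LRpsi (fun _ _ => erefl).
by rewrite /Rintegral E/= p0 subr0.
Qed.

End ApproximateProblem.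

(** * Limits of $L^2$-bounded sequences and of weak-strong products *)

Section WeakLimits.
Local Set Implicit Arguments.
Local Unset Strict Implicit.
Context {R : realType}.
Local Notation mu := (@lebesgue_measure R).
Implicit Types (L x : R) (a g phi u du : R -> R).

(* Vitali-type argument: [h <= min h T + h^2 / T]. *)
Lemma L2_bounded_ae_cvg0 L (h : nat -> R -> R) (Q : R) :
  (forall k, L2 L (h k)) -> (forall k x, 0 <= h k x) ->
  (forall k, Rintegral mu `[0, L]%classic (fun x => h k x ^+ 2) <= Q) ->
  {ae mu, forall x, `[0, L]%classic x -> h k x @[k --> \oo] --> (0 : R)} ->
  Rintegral mu `[0, L]%classic (h k) @[k --> \oo] --> (0 : R).
Proof.
move=> Lh h0 hQ hcvg.
have Q0 : 0 <= Q by apply: le_trans (hQ 0%N); apply: Rintegral_ge0 => x _; rewrite sqr_ge0.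
have mmin k T : measurable_fun (`[0, L]%classic : set (measurableTypeR R)) (fun x => Num.min (h k x) T).
  by have [mh _] := Lh k; exact: measurable_minr.
have imin k T : 0 <= T -> mu.-integrable `[0, L]%classic (EFin \o (fun x => Num.min (h k x) T)).
  move=> T0; apply: (integrable_EFin_dom _ _ _ (integrable_cst_0L L T)) => // x _.
  by rewrite ger0_norm ?ge_min ?lexx ?orbT// le_min h0.
have I0 : Rintegral mu `[0, L]%classic (fun _ => 0) = 0.
  by rewrite /Rintegral integral0.
have cvgmin T : 0 <= T ->
    Rintegral mu `[0, L]%classic (fun x => Num.min (h k x) T) @[k --> \oo] --> (0 : R).
  move=> T0; rewrite -[X in _ --> X]I0.
  apply: (cvg_Rintegral_dominated (g := fun _ => T)) => //.
  - apply: (ae_imp _ hcvg) => x hx Dx; apply/cvgrPdist_lt => e e0.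
    have /cvgrPdist_lt/(_ e e0) := hx Dx; apply: filterS => k.
    rewrite !sub0r !normrN !ger0_norm ?le_min ?h0//.
    by apply: le_lt_trans; rewrite ge_min lexx.
  - exact: integrable_cst_0L.
  - apply: aeW => x _ k.
    by rewrite ger0_norm ?ge_min ?lexx ?orbT// le_min h0.
apply/cvgrPdist_lt => e e0.
(* Makes the tail term [Q / T] smaller than [e / 2]; the [+ 1] covers [Q = 0]. *)
pose T := 2 * (Q + 1) / e.
have T0 : 0 < T by rewrite divr_gt0// mulr_gt0//; lra.
have QT : Q / T < e / 2.
  rewrite /T invf_div mulrA ltr_pdivrMr ?mulr_gt0//; last lra.
  have -> : e / 2 * (2 * (Q + 1)) = Q * e + e by field.
  by lra.
have /cvgrPdist_lt/(_ _ (divr_gt0 e0 (ltr0n _ 2))) := cvgmin T (ltW T0).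
apply: filterS => k; rewrite !sub0r !normrN => hk.
rewrite ger0_norm; last by apply: Rintegral_ge0.
have h2 := L2_integrable_sqr (Lh k).
have key : Rintegral mu `[0, L]%classic (h k) <=
    Rintegral mu `[0, L]%classic (fun x => Num.min (h k x) T + T^-1 * h k x ^+ 2).
  apply: le_Rintegral => //; first exact: L2_integrable.
    apply: integrable_EFinD => //; first by apply: imin; exact: ltW.
    exact: integrable_EFinZ.
  move=> x _; case: (leP (h k x) T) => hT; first by rewrite lerDl mulr_ge0// ?sqr_ge0// invr_ge0 ltW.
  have h1 : h k x <= T^-1 * h k x ^+ 2.
    by rewrite expr2 mulrA ler_peMl// mulrC ler_pdivlMr// mul1r ltW.
  by rewrite (le_trans h1)// lerDr ltW.
apply: (le_lt_trans key); rewrite RintegralD//; last 2 first.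
- by apply: imin; exact: ltW.
- exact: integrable_EFinZ.
rewrite RintegralZl//.
have := hQ k; rewrite -(ler_pM2l (x := T^-1)) ?invr_gt0// => hQk.
move: hk; rewrite ger0_norm; last by apply: Rintegral_ge0 => x _; rewrite le_min h0 ltW.
by rewrite mulrC in QT; lra.
Qed.

(** By Fatou the lower limit of the squares is integrable, hence finite a.e., which excludes the
    value [+oo] of [Y] outside a null set. The differences [w k - f] are then bounded in $L^2$ and
    tend to [0] a.e. *)
Lemma L2_bounded_ae_limit L (w : nat -> R -> R) (Y : R -> \bar R) (Q : R) :
  (forall k, L2 L (w k)) ->
  (forall k, Rintegral mu `[0, L]%classic (fun x => w k x ^+ 2) <= Q) ->
  (forall x, Y x != -oo%E) ->
  {ae mu, forall x, `[0, L]%classic x -> (w k x)%:E @[k --> \oo] --> Y x} ->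
  exists f, [/\ L2 L f, {ae mu, forall x, `[0, L]%classic x -> Y x = (f x)%:E} &
    Rintegral mu `[0, L]%classic (fun x => `|w k x - f x|) @[k --> \oo] --> (0 : R)].
Proof.
move=> Lw wQ YN wY.
have Q0 : 0 <= Q by apply: le_trans (wQ 0%N); apply: Rintegral_ge0 => x _; rewrite sqr_ge0.
pose D : set (measurableTypeR R) := `[0, L]%classic.
have mD : measurable D by rewrite /D.
have mw k : measurable_fun D (EFin \o w k).
  by apply/measurable_EFinP; have [] := Lw k.
have mw2 k : measurable_fun D (EFin \o (fun x => w k x ^+ 2)).
  by have /integrableP[] := L2_integrable_sqr (Lw k).
(* not [fine (Y x)], whose measurability is unclear *)
pose f x := fine (limn_esup (fun k => (w k x)%:E)).
have mf : measurable_fun D f.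
  apply: (@measurable_comp _ _ _ _ _ _ setT fine) => //.
  exact: measurable_fun_limn_esup.
pose q x := limn_einf (fun k => (w k x ^+ 2)%:E).
have mq : measurable_fun D q.
  rewrite (_ : q = fun x => - limn_esup (fun k => - (w k x ^+ 2)%:E))%E.
    apply: measurableT_comp => //.
    apply: measurable_fun_limn_esup => n.
    by apply: (measurableT_comp (f := oppe)); last exact: mw2.
  by apply/funext => x; rewrite /q -[LHS]oppeK -limn_esupN.
have w20 k x : D x -> (0 <= (w k x ^+ 2)%:E)%E by move=> _; rewrite lee_fin sqr_ge0.
have einf_le (v : nat -> \bar R) l : (forall k, (v k <= l)%E) -> (limn_einf v <= l)%E.
  move=> vl; rewrite limn_einf_lim; apply: lime_le; first exact: is_cvg_einfs.
  by apply: nearW => n; apply: ge_ereal_inf; exists (v n) => //; exists n => /=.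
have qQ : (\int[mu]_(x in D) q x <= Q%:E)%E.
  apply: (le_trans (fatou mu mD mw2 w20)).
  apply: einf_le => k; have i2 := L2_integrable_sqr (Lw k).
  by rewrite -[leLHS]fineK ?lee_fin ?integrable_fin_num//; exact: wQ.
have q0 x : (0 <= q x)%E.
  rewrite /q limn_einf_lim; apply: lime_ge; first exact: is_cvg_einfs.
  by apply: nearW => n; apply: le_ereal_inf_tmp => _ [k _ <-]; rewrite lee_fin sqr_ge0.
have iq : mu.-integrable D q.
  apply/integrableP; split => //.
  rewrite (_ : (fun x => `|q x|)%E = q); first exact: le_lt_trans qQ (ltry _).
  by apply/funext => x; rewrite gee0_abs.
have qfin := integrable_ae mD iq.
have main : {ae mu, forall x, D x -> [/\ Y x = (f x)%:E, q x = (f x ^+ 2)%:E &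
    w k x @[k --> \oo] --> f x]}.
  apply: (ae_imp _ (ae_and wY qfin)) => x [h1 h2] Dx.
  have wx := h1 Dx; have qx := h2 Dx.
  have fx : f x = fine (Y x) by rewrite /f (cvg_limn_einf_sup wx).2.
  have {}YN := YN x; case: (Y x) wx fx YN => [r|//|//] wx fx _.
    have wr : w k x @[k --> \oo] --> r by exact (fine_cvg wx).
    rewrite fx /=; split => //.
    rewrite /q; apply: (cvg_limn_einf_sup _).1.
    apply: cvg_EFin; first exact: nearW.
    exact: (cvgM wr wr).
  (* Case [Y x = +oo]: the squares tend to [+oo] too, because [w k x >= |A| + 1] forces
     [w k x ^+ 2 >= A]; this contradicts the finiteness of [q x]. *)
  move: qx; rewrite /q (cvg_limn_einf_sup (l := +oo%E) _).1//.
  apply/cvgeyPge => A; move/cvgeyPge : wx => /(_ (`|A| + 1)).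
  apply: filterS => k; rewrite !lee_fin => hk.
  have := ler_norm A; have := normr_ge0 A; nra.
have Lf : L2 L f.
  split => //=.
  rewrite (_ : (\int[mu]_(x in _) _)%E = (\int[mu]_(x in D) q x)%E).
    exact: le_lt_trans qQ (ltry _).
  apply: ae_eq_integral => //.
    by apply/measurable_EFinP; exact: measurable_funX.
  by apply: (ae_imp _ main) => x hx Dx; have [_ ->] := hx Dx.
exists f; split => //.
  by apply: (ae_imp _ main) => x hx Dx; have [] := hx Dx.
(* The bound comes from $(w-f)^2 \le 2w^2 + 2f^2$. *)
apply: (@L2_bounded_ae_cvg0 _ _ (2 * Q + 2 * Rintegral mu D (fun x => f x ^+ 2))) => //.
- by move=> k; apply: L2_norm; exact: L2B.
- move=> k; have i1 := L2_integrable_sqr (Lw k); have i2 := L2_integrable_sqr Lf.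
  apply: (@le_trans _ _ (2 * Rintegral mu D (fun x => w k x ^+ 2) + 2 * Rintegral mu D (fun x => f x ^+ 2))).
    rewrite -RintegralZl// -[X in _ + X]RintegralZl// -RintegralD//; try exact: integrable_EFinZ.
    apply: le_Rintegral => //.
    + by apply: L2_integrable_sqr; apply: L2_norm; exact: L2B.
    + by apply: integrable_EFinD => //; exact: integrable_EFinZ.
    + move=> x _; rewrite real_normK ?num_real// -subr_ge0.
      by rewrite (_ : _ - _ = (w k x + f x) ^+ 2) ?sqr_ge0//; ring.
  by rewrite lerD2r ler_pM2l.
- apply: (ae_imp _ main) => x hx Dx; have [_ _ wx] := hx Dx.
  have := cvg_norm (cvgB wx (cvg_cst (f x))); rewrite subrr normr0; exact.
Qed.

Lemma cvg_Rintegral_bounded_mul L (w : nat -> R -> R) (f z : R -> R) (C : R) :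
  (forall k, L2 L (w k)) -> L2 L f -> L2 L z -> 
  (forall x, 0 <= x <= L -> `|z x| <= C) ->
  Rintegral mu `[0, L]%classic (fun x => `|w k x - f x|) @[k --> \oo] --> (0 : R) ->
  Rintegral mu `[0, L]%classic (fun x => w k x * z x) @[k --> \oo] -->
  Rintegral mu `[0, L]%classic (fun x => f x * z x).
Proof.
move=> Lw Lf Lz zC h; apply/cvgrPdist_le => e e0.
have C1 : 0 < `|C| + 1 by rewrite ltr_pwDr.
have /cvgrPdist_le/(_ _ (divr_gt0 e0 C1)) := h; apply: filterS => k.
rewrite sub0r normrN ger0_norm; last by apply: Rintegral_ge0 => x _.
rewrite ler_pdivlMr// => hk; apply: le_trans hk.
have i1 := L2M_integrable Lf Lz; have i2 := L2M_integrable (Lw k) Lz.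
have id : mu.-integrable `[0, L]%classic (EFin \o (fun x => `|w k x - f x|)).
  by apply: integrable_EFin_norm; apply: L2_integrable; exact: L2B.
rewrite -RintegralB// mulrC -RintegralZl//.
apply: (le_trans (le_normr_Rintegral _ _)) => //; first exact: integrable_EFinB.
apply: le_Rintegral => //.
- by apply: integrable_EFin_norm; exact: integrable_EFinB.
- exact: integrable_EFinZ.
- move=> x /=; rewrite in_itv/= => /zC zx.
  rewrite -mulrBl normrM distrC mulrC ler_wpM2r//.
  by have := ler_norm C; lra.
Qed.

(** Split $a_k u_k' z = (a_k - a) z u_k' + a z u_k'$. Dominated convergence makes $(a_k-a)z$ small
    in $L^2$, and Cauchy-Schwarz disposes of the first term. Weak convergence is given only against
    derivatives of $H^1_0$ functions, so $az$ is replaced by $az$ minus its mean; this is harmless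
    since $u_k'$ and $u'$ are mean-free. *)
Lemma cvg_Rintegral_coef_deriv L (beta D1 C : R) (an dus us : nat -> R -> R) (a u du z : R -> R) :
  0 < L -> 0 <= beta -> 0 <= D1 ->
  (forall k, measurable_fun `[0, L]%classic (an k)) -> measurable_fun `[0, L]%classic a ->
  (forall k, {ae mu, forall x, `[0, L]%classic x -> `|an k x| <= beta}) ->
  {ae mu, forall x, `[0, L]%classic x -> `|a x| <= beta} ->
  {ae mu, forall x, `[0, L]%classic x -> an k x @[k --> \oo] --> a x} ->
  (forall k, H10 L (us k) (dus k)) -> H10 L u du ->
  (forall k, L2norm L (dus k) <= D1) ->
  (forall v dv, H10 L v dv ->
     Rintegral mu `[0, L]%classic (fun x => dus k x * dv x) @[k --> \oo]
       --> Rintegral mu `[0, L]%classic (fun x => du x * dv x)) ->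
  L2 L z -> (forall x, 0 <= x <= L -> `|z x| <= C) ->
  Rintegral mu `[0, L]%classic (fun x => an k x * dus k x * z x) @[k --> \oo]
   --> Rintegral mu `[0, L]%classic (fun x => a x * du x * z x).
Proof.
move=> L0 b0 D0 man ma anb ab ancvg Hk Hu hD hw Lz zC; have L0' := ltW L0.
have zC' : {ae mu, forall x, `[0, L]%classic x -> `|z x| <= C}.
  by apply: aeW => x /=; rewrite in_itv/=; exact: zC.
have C0 : 0 <= C by apply: le_trans (zC 0 _) => //; rewrite lexx.
have Ldus k : L2 L (dus k) by have [] := Hk k.
have Ldu : L2 L du by have [] := Hu.
have Laz : L2 L (fun x => a x * z x) by exact: L2_bndM ab Lz.
have Lanz k : L2 L (fun x => an k x * z x) by exact: L2_bndM (anb k) Lz.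
have Ld k : L2 L (fun x => (an k x - a x) * z x).
  have := L2B (Lanz k) Laz.
  by congr L2; apply/funext => x; rewrite mulrBl.
have eta : Rintegral mu `[0, L]%classic (fun x => ((an k x - a x) * z x) ^+ 2) @[k --> \oo] --> (0 : R).
  have I0 : Rintegral mu `[0, L]%classic (fun _ => 0) = 0.
    by rewrite /Rintegral integral0.
  rewrite -[X in _ --> X]I0.
  apply: (cvg_Rintegral_dominated (g := fun _ => (2 * beta * C) ^+ 2)) => //.
  - by move=> k; apply: measurable_funX; have [] := Ld k.
  - apply: (ae_imp _ ancvg) => x hx Dx.
    have h1 : (an k x - a x) * z x @[k --> \oo] --> (0 : R).
      by have := cvgM (cvgB (hx Dx) (cvg_cst (a x))) (cvg_cst (z x)); rewrite subrr mul0r; exact.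
    by have := cvgM h1 h1; rewrite mul0r; exact.
  - exact: integrable_cst_0L.
  - apply: (ae_imp _ (ae_and ab (ae_foralln anb))) => x [h1 h2] Dx k.
    have h3 := h1 Dx; have h4 := h2 k Dx.
    have h5 : `|z x| <= C by apply: zC; move: Dx; rewrite /= in_itv.
    rewrite normrX lerXn2r ?nnegrE ?mulr_ge0// normrM ler_pM//.
    by rewrite (le_trans (ler_normB _ _))//; lra.
have A0 : Rintegral mu `[0, L]%classic (fun x => (an k x - a x) * z x * dus k x) @[k --> \oo] --> (0 : R).
  have s0 : L2norm L (fun x => (an k x - a x) * z x) * D1 @[k --> \oo] --> (0 : R).
    rewrite -[X in _ --> X](mul0r D1).
    apply: cvgM; last exact: cvg_cst.
    rewrite /L2norm; have := continuous_cvg _ (@sqrt_continuous R _) eta.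
    by rewrite sqrtr0; exact.
  apply/cvgrPdist_le => e e0; have /cvgrPdist_le/(_ e e0) := s0; apply: filterS => k.
  rewrite !sub0r !normrN => hk; apply: (le_trans _ (le_trans (ler_norm _) hk)).
  apply: (le_trans (Cauchy_Schwarz_L2 (Ld k) (Ldus k))).
  by rewrite ler_wpM2l// L2norm_ge0.
have Hv := H10_mean L0 Laz.
have := hw _ _ Hv; set mm := _ / L => hB.
have split_ v dv : H10 L v dv -> Rintegral mu `[0, L]%classic (fun x => dv x * (a x * z x - mm)) =
   Rintegral mu `[0, L]%classic (fun x => a x * dv x * z x).
  move=> Hdv; have [Ldv _] := Hdv.
  transitivity (Rintegral mu `[0, L]%classic (fun x => dv x * (a x * z x) - mm * dv x)).
    by apply: eq_Rintegral => x _; ring.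
  rewrite RintegralB//; last 2 first.
  - exact: L2M_integrable.
  - by apply: integrable_EFinZ => //; exact: L2_integrable.
  rewrite RintegralZl//; last exact: L2_integrable.
  rewrite (H10_Rintegral_deriv L0' Hdv) mulr0 subr0.
  by apply: eq_Rintegral => x _; ring.
have EE k : Rintegral mu `[0, L]%classic (fun x => an k x * dus k x * z x) =
    Rintegral mu `[0, L]%classic (fun x => (an k x - a x) * z x * dus k x) +
    Rintegral mu `[0, L]%classic (fun x => dus k x * (a x * z x - mm)).
  rewrite (split_ _ _ (Hk k)) -RintegralD//; last 2 first.
  - exact: L2M_integrable.
  - have := L2M_integrable Laz (Ldus k).
    by congr integrable; apply/funext => x /=; congr EFin; ring.
  by apply: eq_Rintegral => x _; ring.
rewrite (funext EE) -(split_ _ _ Hu) -[X in _ --> X]add0r.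
exact: cvgD A0 hB.
Qed.

End WeakLimits.

(** * Subsequences, boundedness of the constants, passage to the limit *)

Section LimitPassage.
Local Set Implicit Arguments.
Local Unset Strict Implicit.
Context {R : realType}.
Local Notation mu := (@lebesgue_measure R).
Implicit Types (L x : R) (a g u du : R -> R).

Lemma subseq_ge (sigma : nat -> nat) : (forall k, (sigma k < sigma k.+1)%N) ->
  forall k, (k <= sigma k)%N.
Proof. by move=> h; elim=> // k IH; exact: leq_ltn_trans IH (h k). Qed.

Lemma cvg_subseq (T : topologicalType) (v : nat -> T) (l : T) (sigma : nat -> nat) :
  (forall k, (sigma k < sigma k.+1)%N) -> v @ \oo --> l ->
  v (sigma k) @[k --> \oo] --> l.
Proof.
move=> hs vl A /vl[N _ hN]; exists N => // k /= Nk; apply: hN => /=.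
exact: leq_trans Nk (subseq_ge hs k).
Qed.

(** [reasonable_approx] speaks of sequences indexed by every [n]. The indices missed by [sigma] are
    filled with the limit [s0], which preserves convergence; injectivity of [sigma] makes the filled
    sequence agree with [s] along [sigma]. *)
Lemma reasonable_approx_subseq (phin : nat -> R -> R) (phi : R -> \bar R) (sigma : nat -> nat) :
  (forall k, (sigma k < sigma k.+1)%N) -> reasonable_approx phin phi ->
  reasonable_approx (fun k => phin (sigma k)) phi.
Proof.
move=> hs H s s0 ss.
have smono i j : (i < j)%N -> (sigma i < sigma j)%N.
  elim: j => // j IH; rewrite ltnS leq_eqVlt => /predU1P[->|/IH /ltn_trans]; first exact: hs.
  by apply; exact: hs.
have sinj i j : sigma i = sigma j -> i = j.
  by move=> E; case: (ltngtP i j) => // /smono; rewrite E ltnn.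
pose s' n := if pselect (exists k, sigma k = n) is left e then s (projT1 (cid e)) else s0.
have s'E k : s' (sigma k) = s k.
  rewrite /s'; case: pselect => [e|]; last by case; exists k.
  by case: cid => j /= /sinj ->.
have s's : s' @ \oo --> s0.
  apply/cvgrPdist_lt => e e0; have /cvgrPdist_lt/(_ e e0)[N _ hN] := ss.
  exists (sigma N) => // n /= Nn; rewrite /s'; case: pselect => [h|_]; last first.
    by rewrite subrr normr0.
  case: cid => j /= jn; apply: hN => /=.
  by rewrite leqNgt; apply/negP => /smono; rewrite jn ltnNge Nn.
have := cvg_subseq hs (H _ _ s's).
by under eq_fun do rewrite s'E.
Qed.

(* On [`[p, q]], [min |m k| T <= |r k| + Phi + min (|w k| - Phi)^+ T], where the last
   term tends to [0] by dominated convergence; then choose [T] large. *)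
Lemma constants_bounded L (p q Phi C1 : R) (w r : nat -> R -> R) (m : nat -> R) (Y : R -> R) :
  0 <= p -> p < q -> q <= L -> 0 <= Phi ->
  (forall k, L2 L (w k)) -> (forall k, L2 L (r k)) ->
  (forall k, Rintegral mu `[0, L]%classic (fun x => `|r k x|) <= C1) ->
  (forall k, {ae mu, forall x, `[0, L]%classic x -> w k x = r k x - m k}) ->
  {ae mu, forall x, `[p, q]%classic x -> w k x @[k --> \oo] --> Y x /\ `|Y x| <= Phi} ->
  exists T, \forall k \near \oo, `|m k| <= T.
Proof.
move=> p0 pq qL Phi0 Lw Lr rC wE wY.
have L0 : 0 <= L by lra.
have sub : `[p, q]%classic `<=` (`[0, L]%classic : set R).
  by apply: subset_itv; rewrite bnd_simp.
pose J : set (measurableTypeR R) := `[p, q]%classic.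
have mJ : measurable J by rewrite /J.
have muJ : mu J = (q - p)%:E by rewrite /J lebesgue_measure_itv/= lte_fin pq.
have C10 : 0 <= C1 by apply: le_trans (rC 0%N); exact: Rintegral_ge0.
have cJ c : Rintegral mu J (fun _ => c) = c * (q - p).
  by rewrite Rintegral_cst//; congr (_ * _); have /= -> := muJ.
have iJc c : mu.-integrable J (EFin \o (fun _ => c)).
  by apply: integrableS (integrable_cst_0L L c).
have l0 : 0 < q - p by rewrite subr_gt0.
(* Chosen so that [T * (q - p)] exceeds [C1 + Phi * (q - p) + 1], the bound that [|m k| > T] would
   impose on it once the integral of [v k] is below [1]. *)
pose T := (C1 + 1) / (q - p) + Phi + 1.
have T0 : 0 < T by rewrite ltr_pwDr// addr_ge0// divr_ge0 ?ltW//; lra.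
pose v k x := Num.min (Num.max (`|w k x| - Phi) 0) T.
have v0 k x : 0 <= v k x by rewrite le_min le_max lexx orbT/= ltW.
have vT k x : v k x <= T by rewrite ge_min lexx orbT.
have mv k : measurable_fun J (v k).
  apply: (@measurable_funS _ _ _ _ (`[0, L]%classic : set (measurableTypeR R))) => //.
  have [mw _] := Lw k; apply: measurable_minr => //; apply: measurable_maxr => //.
  by apply: measurable_funB => //; exact: measurableT_comp.
have iv k : mu.-integrable J (EFin \o v k).
  by apply: (integrable_EFin_dom _ _ _ (iJc T)) => // x _; rewrite ger0_norm.
have cvgv : Rintegral mu J (v k) @[k --> \oo] --> (0 : R).
  have I0 : Rintegral mu J (fun _ => 0) = 0 by rewrite cJ mul0r.
  rewrite -[X in _ --> X]I0.
  apply: (cvg_Rintegral_dominated (g := fun _ => T)) => //.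
    apply: (ae_imp _ wY) => x h Jx; have [wx Yx] := h Jx.
    apply/cvgrPdist_lt => e e0; have /cvgrPdist_lt/(_ e e0) := wx.
    apply: filterS => k hk; rewrite sub0r normrN ger0_norm//.
    rewrite gt_min gt_max e0 andbT; apply/orP; left.
    by have := lerB_dist (w k x) (Y x); rewrite distrC in hk; lra.
  by apply: aeW => x _ k; rewrite ger0_norm.
exists T; have /cvgrPdist_lt/(_ 1 ltr01) := cvgv; apply: filterS => k.
rewrite sub0r normrN ger0_norm; last by apply: Rintegral_ge0 => x _; exact: v0.
move=> hv; rewrite leNgt; apply/negP => Tm.
have ir : mu.-integrable `[0, L]%classic (EFin \o (fun x => `|r k x|)).
  by apply: integrable_EFin_norm; exact: L2_integrable.
have irJ : mu.-integrable J (EFin \o (fun x => `|r k x|)) by exact: integrableS ir.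
have : Rintegral mu J (fun _ => T) <=
    Rintegral mu J (fun x => (`|r k x| + Phi) + v k x).
  apply: ae_le_Rintegral => //.
    by apply: integrable_EFinD => //; exact: integrable_EFinD.
  apply: (ae_imp _ (wE k)) => x h Jx; have := h (sub _ Jx) => wx.
  have h1 : `|m k| <= `|r k x| + `|w k x|.
    have -> : m k = r k x - w k x by rewrite wx; ring.
    exact: ler_normB.
  have := normr_ge0 (r k x).
  rewrite /v; set V := Num.max _ _.
  have V1 : `|w k x| - Phi <= V by rewrite le_max lexx.
  have V2 : 0 <= V by rewrite le_max lexx orbT.
  by case: (leP V T) => h3; lra.
rewrite (RintegralD mJ (integrable_EFinD mJ irJ (iJc Phi)) (iv k)).
rewrite (RintegralD mJ irJ (iJc Phi)) !cJ.
have : Rintegral mu J (fun x => `|r k x|) <= C1.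
  apply: le_trans (rC k).
  apply: fine_le; [exact: integrable_fin_num|exact: integrable_fin_num|].
  apply: ge0_subset_integral => //.
  by case/integrableP : ir.
have TE : T * (q - p) = C1 + 1 + (Phi + 1) * (q - p).
  by rewrite /T; field; rewrite gt_eqF.
by rewrite TE; nra.
Qed.

Lemma limit_passage L (alpha beta c0 : R) a g (phi : R -> \bar R)
  (an gn phin : nat -> R -> R) (us dus : nat -> R -> R) u du :
  0 < L -> 0 < alpha -> alpha <= beta ->
  measurable_fun `[0, L]%classic a -> ae_on L (fun x => alpha <= a x <= beta) ->
  L2 L g -> H_phi phi ->
  (forall n, measurable_fun `[0, L]%classic (an n)) ->
  (forall n, ae_on L (fun x => alpha <= an n x <= beta)) ->
  ae_on L (fun x => an n x @[n --> \oo] --> a x) ->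
  (forall n, L2 L (gn n)) -> (forall n, L2norm L (gn n) <= c0) ->
  (forall w, L2 L w ->
     Rintegral mu `[0, L]%classic (fun x => gn n x * w x) @[n --> \oo]
       --> Rintegral mu `[0, L]%classic (fun x => g x * w x)) ->
  reasonable_approx phin phi -> (forall n, continuous (phin n)) ->
  (forall k, H10 L (us k) (dus k)) ->
  (forall k, approx_eq L (an k) (gn k) (phin k) (us k) (dus k)) ->
  H10 L u du ->
  (forall z dz, H10 L z dz ->
    Rintegral mu `[0, L]%classic (fun x => dus k x * dz x) @[k --> \oo]
      --> Rintegral mu `[0, L]%classic (fun x => du x * dz x)) ->
  ae_on L (fun x => us k x @[k --> \oo] --> u x) ->
  (forall x, 0 <= x <= L -> u x = 0) \/ weak_solution L a g phi u du.
Proof.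
move=> L0 al0 ab ma aab Lg [cphi [phiN phiy]] man anab ancvg Lgn gnc gnw rphi cphin Hk eqk Hu wdu cvgu.
have L0' := ltW L0.
have [|/existsNP[x0 /not_implyP[x0L ux0]]] := pselect (forall x, 0 <= x <= L -> u x = 0).
  by left.
right.
have b0 : 0 <= beta by lra.
have abs_le (f : R -> R) : ae_on L (fun x => alpha <= f x <= beta) ->
    {ae mu, forall x, `[0, L]%classic x -> `|f x| <= beta}.
  move=> h; apply: (ae_imp _ (ae_on_cc h)) => x hx Dx; have /andP[h1 h2] := hx Dx.
  by rewrite ger0_norm//; lra.
have anb k := abs_le _ (anab k); have ab' := abs_le _ aab.
have Ldus k : L2 L (dus k) by have [] := Hk k.
pose w k x := phin k (us k x).
have Lw k : L2 L (w k) by exact: comp_H10_L2 L0' (Hk k) (cphin k).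
have c00 : 0 <= c0 := le_trans (L2norm_ge0 _ _) (gnc 0%N).
pose D1 := c0 / alpha.
have D10 : 0 <= D1 by rewrite divr_ge0// ltW.
have dusD k : L2norm L (dus k) <= D1.
  apply: (le_trans (energy_estimate L0' al0 (man k) (anab k) (Lgn k) (cphin k) (Hk k) (eqk k))).
  by rewrite ler_pM2r ?invr_gt0.
have dus2 k : Rintegral mu `[0, L]%classic (fun x => dus k x ^+ 2) <= D1 ^+ 2.
  by rewrite -sqr_L2norm lerXn2r ?nnegrE ?L2norm_ge0.
have gn2 k : Rintegral mu `[0, L]%classic (fun x => gn k x ^+ 2) <= c0 ^+ 2.
  by rewrite -sqr_L2norm lerXn2r ?nnegrE ?L2norm_ge0.
pose r k x := an k x * dus k x - gn k x.
have Ladus k : L2 L (fun x => an k x * dus k x) by exact: L2_bndM (man k) (anb k) (Ldus k).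
have Lr k : L2 L (r k) by exact: L2B.
(* From $(x-y)^2 \le 2x^2 + 2y^2$ and the bound [beta] on the coefficients. *)
pose Q1 := 2 * beta ^+ 2 * D1 ^+ 2 + 2 * c0 ^+ 2.
have r2 k : Rintegral mu `[0, L]%classic (fun x => r k x ^+ 2) <= Q1.
  have i1 := L2_integrable_sqr (Ldus k); have i2 := L2_integrable_sqr (Lgn k).
  apply: (@le_trans _ _ (2 * beta ^+ 2 * Rintegral mu `[0, L]%classic (fun x => dus k x ^+ 2) +
     2 * Rintegral mu `[0, L]%classic (fun x => gn k x ^+ 2))).
    rewrite -RintegralZl// -[X in _ + X]RintegralZl// -RintegralD//; try exact: integrable_EFinZ.
    apply: ae_le_Rintegral => //.
    - exact: L2_integrable_sqr.
    - by apply: integrable_EFinD => //; exact: integrable_EFinZ.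
    apply: (ae_imp _ (anb k)) => x h Dx; have /ler_normlP[h1 h2] := h Dx.
    apply: (@le_trans _ _ (2 * (an k x * dus k x) ^+ 2 + 2 * gn k x ^+ 2)).
      rewrite -subr_ge0 /r.
      by rewrite (_ : _ - _ = (an k x * dus k x + gn k x) ^+ 2) ?sqr_ge0//; ring.
    rewrite lerD2r -mulrA ler_pM2l// exprMn ler_wpM2r ?sqr_ge0//.
    by rewrite -real_normK ?num_real// lerXn2r ?nnegrE// h.
  apply: lerD; last by rewrite ler_pM2l.
  by rewrite ler_wpM2l ?mulr_ge0 ?sqr_ge0.
have r1 k : Rintegral mu `[0, L]%classic (fun x => `|r k x|) <= Q1 + L.
  have i1 := L2_integrable_sqr (Lr k).
  apply: (@le_trans _ _ (Rintegral mu `[0, L]%classic (fun x => r k x ^+ 2 + 1))).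
    apply: le_Rintegral => //.
    - by apply: integrable_EFin_norm; exact: L2_integrable.
    - by apply: integrable_EFinD => //; exact: integrable_cst_0L.
    - move=> x _; rewrite -[r k x ^+ 2]real_normK ?num_real//.
      by have := normr_ge0 (r k x); set s := `|_|; nra.
  rewrite RintegralD//; last exact: integrable_cst_0L.
  by rewrite Rintegral_cst_0L// mul1r lerD2r.
have /choice[m wE] : forall k, exists m,
    {ae mu, forall x, `[0, L]%classic x -> w k x = r k x - m}.
  by move=> k; exact (approx_eq_flux L0 (man k) (anb k) (Lgn k) (cphin k) (Hk k) (eqk k)).
have wphi : {ae mu, forall x, `[0, L]%classic x -> (w k x)%:E @[k --> \oo] --> phi (u x)}.
  by apply: (ae_imp _ (ae_on_cc cvgu)) => x h Dx; apply: rphi; exact: h.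
have cu := H10_continuous L0' Hu.
have phi_fin s : s != 0 -> phi s = (fine (phi s))%:E.
  move=> s0; rewrite fineK// fin_numE phiN phiy//.
(* Since [u x0] is nonzero, [phi (u x0)] is finite, and continuity keeps [phi] finite and within [1]
   of that value on a ball. *)
have [d1 d10 hd1] : exists2 d1, 0 < d1 & forall s, `|u x0 - s| < d1 ->
    phi s = (fine (phi s))%:E /\ `|fine (phi s)| <= `|fine (phi (u x0))| + 1.
  have : phi s @[s --> u x0] --> phi (u x0) := cphi (u x0).
  rewrite (phi_fin (u x0)); last exact/eqP.
  move=> /fine_cvgP[hfin /cvgrPdist_lt/(_ 1 ltr01) h1].
  have /nbhs_ballP[d1 /= d10 hd] : nbhs (u x0) [set s | phi s \is a fin_num /\
      `|fine (phi (u x0)) - fine (phi s)| < 1] by exact (filterI hfin h1).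
  exists d1 => // s /hd /= [sfin hs]; split; first by rewrite fineK.
  have := lerB_dist (fine (phi s)) (fine (phi (u x0))).
  by rewrite distrC; lra.
have Dx0 : `[0, L]%classic x0 by rewrite /= in_itv.
have [d d0 hd] := within_continuous_dist cu Dx0 d10.
have /andP[x00 x0L'] := x0L.
(* Halving [d] keeps the closed interval strictly within distance [d] of [x0]; cutting at [0] and
   [L] leaves positive length wherever [x0] lies in [[0, L]]. *)
pose p := Num.max 0 (x0 - d / 2); pose q := Num.min L (x0 + d / 2).
have p0 : 0 <= p by rewrite le_max lexx.
have qL : q <= L by rewrite ge_min lexx.
have d2 : 0 < d / 2 by rewrite divr_gt0.
have pq : p < q by rewrite gt_max !lt_min L0/=; apply/andP; split; [|apply/andP; split]; lra.
have [T hT] : exists T, \forall k \near \oo, `|m k| <= T.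
  apply: (@constants_bounded L p q (`|fine (phi (u x0))| + 1) (Q1 + L) w r m
    (fun x => fine (phi (u x)))) => //.
  apply: (ae_imp _ wphi) => x h; rewrite /= in_itv/= => /andP[px xq].
  have xL : `[0, L]%classic x by rewrite /= in_itv/= (le_trans p0 px) (le_trans xq qL).
  have : `|x0 - x| < d.
    move: px xq; rewrite ge_max le_min => /andP[_ px] /andP[_ xq].
    by rewrite ltr_norml; lra.
  move=> /(hd _ xL)/hd1[E hb]; split => //.
  by have := h xL; rewrite E => h'; exact (fine_cvg h').
(* The constants are bounded only eventually, so all sequences are shifted by [k0] from here on. *)
have [k0 _ hk0] := hT.
have mT k : `|m (k + k0)%N| <= T by apply: hk0 => /=; exact: leq_addl.
pose Q := 2 * Q1 + 2 * T ^+ 2 * L.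
have w2 k : Rintegral mu `[0, L]%classic (fun x => w (k + k0)%N x ^+ 2) <= Q.
  set j := (k + k0)%N; have i1 := L2_integrable_sqr (Lr j).
  apply: (@le_trans _ _ (Rintegral mu `[0, L]%classic (fun x => 2 * r j x ^+ 2 + 2 * T ^+ 2))).
    apply: ae_le_Rintegral => //.
    - exact: L2_integrable_sqr.
    - by apply: integrable_EFinD; [|exact: integrable_EFinZ|exact: integrable_cst_0L].
    apply: (ae_imp _ (wE j)) => x h Dx; rewrite (h Dx).
    have : m j ^+ 2 <= T ^+ 2.
      rewrite -real_normK ?num_real// lerXn2r ?nnegrE//; last exact: mT.
      exact: le_trans (mT k).
    have := sqr_ge0 (r j x + m j); nra.
  rewrite RintegralD//; [|exact: integrable_EFinZ|exact: integrable_cst_0L].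
  by rewrite RintegralZl// Rintegral_cst_0L// lerD2r ler_pM2l.
have [||f [Lf phif wf]] := @L2_bounded_ae_limit R L (fun k => w (k + k0)%N)
  (fun x => phi (u x)) Q (fun k => Lw _) w2.
- by move=> x; exact: phiN.
- apply: (ae_imp _ wphi) => x h Dx; have := h Dx.
  by rewrite -(cvg_shiftn k0).
split => //; exists f; split => //; split.
  by apply: (ae_imp _ phif) => x h Dx; apply: h; exact: subset_itv_oo_cc Dx.
move=> psi tpsi; have [Hpsi [C C0 psiC]] := test_fun_H10 L0 tpsi; have [Lpsi _] := Hpsi.
have lim1 := cvg_Rintegral_coef_deriv L0 b0 D10 man ma anb ab' (ae_on_cc ancvg) Hk Hu dusD wdu Lpsi psiC.
have lim2 := cvg_Rintegral_bounded_mul (fun k => Lw (k + k0)%N) Lf Lpsi psiC wf.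
have lim3 := gnw _ Lpsi.
have {}lim1 : Rintegral mu `[0, L]%classic
    (fun x => an (k + k0)%N x * dus (k + k0)%N x * derive1 psi x) @[k --> \oo] -->
    Rintegral mu `[0, L]%classic (fun x => a x * du x * derive1 psi x).
  by move: lim1; rewrite -(cvg_shiftn k0).
have {}lim3 : Rintegral mu `[0, L]%classic (fun x => gn (k + k0)%N x * derive1 psi x) @[k --> \oo] -->
    Rintegral mu `[0, L]%classic (fun x => g x * derive1 psi x).
  by move: lim3; rewrite -(cvg_shiftn k0).
have E k : Rintegral mu `[0, L]%classic
    (fun x => an (k + k0)%N x * dus (k + k0)%N x * derive1 psi x) =
  Rintegral mu `[0, L]%classic (fun x => w (k + k0)%N x * derive1 psi x) +
  Rintegral mu `[0, L]%classic (fun x => gn (k + k0)%N x * derive1 psi x).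
  exact (eqk _ _ _ Hpsi).
rewrite (funext E) in lim1.
exact (cvg_unique (@norm_hausdorff _ _) lim1 (cvgD lim2 lim3)).
Qed.

End LimitPassage.
Theorem mainTheorem1 (R : realType) (L : R) (a g : R -> R) (phi : R -> \bar R)
  (alpha beta c0 : R) (an gn : nat -> R -> R) (phin : nat -> R -> R) :
  0 < L -> 0 < alpha -> alpha < beta -> 0 < c0 ->
  (* (H_a) *)
  measurable_fun `[0, L]%classic a -> ae_on L (fun x => alpha <= a x <= beta) ->
  L2 L g ->
  H_phi phi -> phi 0 = +oo%E ->
  (* (H_approx) *)
  (forall n, measurable_fun `[0, L]%classic (an n)) ->
  (forall n, ae_on L (fun x => alpha <= an n x <= beta)) ->
  ae_on L (fun x => an n x @[n --> \oo] --> a x) ->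
  (forall n, L2 L (gn n)) -> (forall n, L2norm L (gn n) <= c0) ->
  (forall w, L2 L w ->
     Rintegral lebesgue_measure `[0, L]%classic (fun x => gn n x * w x) @[n --> \oo]
       --> Rintegral lebesgue_measure `[0, L]%classic (fun x => g x * w x)) ->
  reasonable_approx phin phi -> (forall n, continuous (phin n)) ->
  (* existence *)
  (forall n, exists u du, H10 L u du /\ approx_eq L (an n) (gn n) (phin n) u du)
  /\
  (* a priori estimate *)
  (forall n u du, H10 L u du -> approx_eq L (an n) (gn n) (phin n) u du ->
     L2norm L du <= L2norm L (gn n) / alpha /\ L2norm L (gn n) / alpha <= c0 / alpha)
  /\
  (* passage to the limit along subsequences *)
  (forall (sigma : nat -> nat), (forall k, (sigma k < sigma k.+1)%N) ->
   forall (us dus : nat -> R -> R),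
     (forall k, H10 L (us k) (dus k) /\
        approx_eq L (an (sigma k)) (gn (sigma k)) (phin (sigma k)) (us k) (dus k)) ->
   forall u du, H10 L u du ->
     (forall z dz, H10 L z dz ->
        Rintegral lebesgue_measure `[0, L]%classic (fun x => dus k x * dz x) @[k --> \oo]
          --> Rintegral lebesgue_measure `[0, L]%classic (fun x => du x * dz x)) ->
     ae_on L (fun x => us k x @[k --> \oo] --> u x) ->
     (forall x, 0 <= x <= L -> u x = 0) \/ weak_solution L a g phi u du).

Proof.
move=> L0 al0 ab c00 ma aab Lg Hphi phi0 man anab ancvg Lgn gnc gnw rphi cphin.
have L0' := ltW L0; have ab' := ltW ab.
split; [|split].
- by move=> n; exact (approx_problem_solvable L0 al0 ab' (man n) (anab n) (Lgn n) (@cphin n)).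
- move=> n u du Hu eq; split.
    exact (energy_estimate L0' al0 (man n) (anab n) (Lgn n) (@cphin n) Hu eq).
  by rewrite ler_pM2r ?invr_gt0.
move=> sigma hs us dus Hk u du Hu wdu cvgu.
(* The hypotheses on the data pass to the subsequence; reasonable approximation is the one that
   takes an argument. *)
apply: (@limit_passage R L alpha beta c0 a g phi (fun k => an (sigma k))
  (fun k => gn (sigma k)) (fun k => phin (sigma k)) us dus) => //.
- by apply: (ae_imp _ ancvg) => x h Dx; exact: (cvg_subseq hs (h Dx)).
- by move=> w Lw; exact: (cvg_subseq hs (gnw w Lw)).
- exact: reasonable_approx_subseq.
- by move=> k; have [] := Hk k.
- by move=> k; have [] := Hk k.
Qed.
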